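(* For $p\in[0,1]$ let $\mathsf S_p\in(\mathbb C^2)^{\otimes4}$ be the $4$-tensor $$\mathsf S_p=\sqrt{\tfrac p2}\,\big(e_1^{\otimes4}+e_2^{\otimes4}\big)+\sqrt{\tfrac{1-p}2}\,\big(e_1\otimes e_2\otimes e_1\otimes e_2+e_2\otimes e_1\otimes e_2\otimes e_1\big),$$ with legs labelled $A,B,C,D$ in order. Let $\theta\in\mathcal P^4_{\mathrm{lam}}$ be such that $\theta(AB|CD)>0$. Then for all $p\in(0,1/2)\cup(1/2,1)$, $$E_\theta(\mathsf S_p)<E^\theta(\mathsf S_p).$$
   Context: **Bipartitions.** Here $k=4$, and the four legs $1,2,3,4$ are denoted $A,B,C,D$. $V=V_1\otimes\cdots\otimes V_k$, $V_i=\mathbb C^{d_i}$ with standard inner product, $V_S=\bigotimes_{i\in S}V_i$. A bipartition of $[k]$ is an unordered pair $b=\{S,\overline S\}$ with $\emptyset\ne S\subsetneq[k]$, $\overline S=[k]\setminus S$; $AB|CD$ denotes $\{\{A,B\},\{C,D\}\}$. Two bipartitions $\{S,\overline S\}$, $\{T,\overline T\}$ are mutually laminar if there are $X\in\{S,\overline S\}$, $Y\in\{T,\overline T\}$ with $X\subseteq Y$; a set of bipartitions is laminar if its members are pairwise mutually laminar. $\mathcal P^k_{\mathrm{lam}}$ is the set of probability distributions on bipartitions of $[k]$ with laminar support. **Logarithmic lower quantum functional.** For $\psi\neq0$ let $\psi_S:V_{\overline S}^*\to V_S$ be the flattening, $\rho_S=\psi_S\psi_S^*/\|\psi\|_2^2$,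 $H_b(\psi)=H(\rho_S)$ the von Neumann entropy (base 2), $H_\theta=\sum_b\theta(b)H_b$, $E_\theta(\psi)=\sup_{A_j\in\mathrm{GL}(V_j)}H_\theta((A_1\otimes\cdots\otimes A_k)\psi)$. **Logarithmic upper quantum functional.** For $n\ge1$ and $\lambda\vdash n$, let $P_\lambda^{V_S}$ be the projector on $V^{\otimes n}\cong V_S^{\otimes n}\otimes V_{\overline S}^{\otimes n}$ onto the $\lambda$-isotypic component of the symmetric group $S_n$ permuting the factors of $V_S^{\otimes n}$ (acting trivially on $V_{\overline S}^{\otimes n}$), $P_{(n)}^{V_{[k]}}$ the projector onto the symmetric subspace of $V^{\otimes n}$, and $P_\lambda^{V_b}=P_\lambda^{V_S}P_{(n)}^{V_{[k]}}$ for $b=\{S,\overline S\}$ (independent of the side; these commute for mutually laminar bipartitions). For $\theta\in\mathcal P^k_{\mathrm{lam}}$, $E^\theta(\psi)=\sup\sum_{b\in\mathrm{supp}\,\theta}\theta(b)H(\lambda^{(b)}/n)$ over all $n\ge1$ and tuples of partitions $\lambda^{(b)}\vdash n$ with $\big(\prod_{b\in\mathrm{supp}\,\theta}P^{V_b}_{\lambda^{(b)}}\big)\psi^{\otimes n}\ne0$, where $H$ is Shannon entropy (base 2). *)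

(* Defs.v *)
From HB Require Import structures.
From mathcomp Require Import all_boot all_order all_algebra all_fingroup.
From mathcomp Require Import spectral.
From mathcomp Require Import all_classical all_reals all_analysis.
From mathcomp Require Import complex.

Set Implicit Arguments.
Unset Strict Implicit.
Unset Printing Implicit Defensive.

Import Order.TTheory GRing.Theory Num.Theory.
Local Open Scope classical_set_scope.
Local Open Scope complex_scope.
Local Open Scope sesquilinear_scope.
Local Open Scope ring_scope.

Definition is_bipartition k (b : {set {set 'I_k}}) : bool :=
  [exists S : {set 'I_k}, [&& S != finset.set0, S != [set: 'I_k]%SET
                            & b == [set S; finset.setC S]%SET]].

Definition bipartition (k : nat) := {b : {set {set 'I_k}} | is_bipartition b}.

(* One of the two sides.  Which one is irrelevant: the quantities computed from
   it below only depend on the unordered pair. *)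
Definition bip_side k (b : bipartition k) : {set 'I_k} :=
  odflt finset.set0 [pick S : {set 'I_k} | S \in val b].

Definition mutually_laminar k (b c : bipartition k) : bool :=
  [exists X in val b, exists Y in val c, X \subset Y].

Definition bip_supp (R : realType) k (theta : {ffun bipartition k -> R}) :
    {set bipartition k} :=
  [set b | theta b != 0]%SET.

Definition laminar_distr (R : realType) k
    (theta : {ffun bipartition k -> R}) : Prop :=
  [/\ forall b, 0 <= theta b,
      \sum_b theta b = 1 &
      {in bip_supp theta &, forall b c, mutually_laminar b c}].

Definition log2 (R : realType) (x : R) : R := ln x / ln 2.

(* The convention 0 log 0 = 0 holds since ln 0 = 0. *)
Definition shannon (R : realType) (s : seq R) : R :=
  - \sum_(x <- s) x * log2 x.

(* Shannon entropy of the eigenvalues, for a positive semidefinite rho *)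
Definition von_neumann (R : realType) n (rho : 'M[R[i]]_n) : R :=
  shannon [seq complex.Re (spectral_diag rho ord0 i) | i : 'I_n].

(* Functions on a finite type as a complex inner product space with the
   standard inner product, the basis of point masses being orthonormal *)
Notation cvec R T := {ffun T -> R[i]^o}.

Definition inner (R : realType) (T : finType) (u v : cvec R T) : R[i] :=
  \sum_x (u x : R[i]) * (v x)^*.

(* The basis vector of V_1 (x) ... (x) V_k indexed by x is
   e_(x 0) (x) ... (x) e_(x (k-1)); here every V_j is C^d. *)
Notation midx k d := {ffun 'I_k -> 'I_d}.

Notation tensor R k d := (cvec R (midx k d)).

Definition etens (R : realType) k d (t : k.-tuple 'I_d) : tensor R k d :=
  [ffun x : midx k d => ([forall j, x j == tnth t j]%:R : R[i])].

(* Indices of the product basis of V_S *)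
Notation sub_midx d S := {ffun {j | j \in S} -> 'I_d}.

Definition restr k d (S : {set 'I_k}) (x : midx k d) : sub_midx d S :=
  [ffun j => x (val j)].

(* Matrix of psi_S : V_(~S)^* -> V_S *)
Definition flattening (R : realType) k d (S : {set 'I_k}) (psi : tensor R k d) :
    'M[R[i]]_(#|{: sub_midx d S}|, #|{: sub_midx d (finset.setC S)}|) :=
  \sum_(x : midx k d) (psi x : R[i]) *:
    delta_mx (enum_rank (restr S x)) (enum_rank (restr (finset.setC S) x)).

Definition reduced_density (R : realType) k d (S : {set 'I_k})
    (psi : tensor R k d) : 'M[R[i]]_(#|{: sub_midx d S}|) :=
  (inner psi psi)^-1 *: (flattening S psi *m (flattening S psi)^t*).

Definition bip_entropy (R : realType) k d (b : bipartition k)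
    (psi : tensor R k d) : R :=
  von_neumann (reduced_density (bip_side b) psi).

Definition local_act (R : realType) k d (A : 'I_k -> 'M[R[i]]_d)
    (psi : tensor R k d) : tensor R k d :=
  [ffun x : midx k d => \sum_(y : midx k d) (\prod_j A j (x j) (y j)) * (psi y : R[i])].

Definition entropy_mix (R : realType) k d (theta : {ffun bipartition k -> R})
    (psi : tensor R k d) : R :=
  \sum_b theta b * bip_entropy b psi.

Definition lower_functional (R : realType) k d
    (theta : {ffun bipartition k -> R}) (psi : tensor R k d) : \bar R :=
  ereal_sup [set h : \bar R | exists A : 'I_k -> 'M[R[i]]_d,
    (forall j, A j \in unitmx) /\
    h = (entropy_mix theta (local_act A psi))%:E].

Definition is_part (n : nat) (lambda : seq nat) : bool :=
  [&& sorted geq lambda, 0%N \notin lambda & sumn lambda == n].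

(* Row and column of the cell carrying the entry a (counted from 0) in the
   Young tableau of shape lambda filled row by row *)
Definition cell_row (lambda : seq nat) (a : nat) := reshape_index lambda a.
Definition cell_col (lambda : seq nat) (a : nat) := reshape_offset lambda a.

Definition row_stab n (lambda : seq nat) : {set 'S_n} :=
  [set s : 'S_n | [forall a : 'I_n,
    cell_row lambda (s a) == cell_row lambda a]]%SET.

Definition col_stab n (lambda : seq nat) : {set 'S_n} :=
  [set s : 'S_n | [forall a : 'I_n,
    cell_col lambda (s a) == cell_col lambda a]]%SET.

(* The group algebra C[S_n]: x stands for \sum_g x(g) g *)
Notation group_alg R n := (cvec R 'S_n).

Definition ga_act (R : realType) n (s : 'S_n) (x : group_alg R n) :
    group_alg R n :=
  [ffun g => x (s^-1 * g)%g].

Definition young_sym (R : realType) n (lambda : seq nat) : group_alg R n :=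
  [ffun g => \sum_(r in row_stab n lambda)
               \sum_(q in col_stab n lambda | (r * q)%g == g)
                 ((-1) ^+ odd_perm q : R[i])].

(* The left ideal generated by the Young symmetrizer: the irreducible
   S_n-module attached to lambda *)
Definition specht (R : realType) n (lambda : seq nat) : {vspace group_alg R n} :=
  <<[seq ga_act s (young_sym R n lambda) | s : 'S_n]>>%VS.

(* x a j is the basis index in leg j of the a-th copy of V *)
Notation pidx k d n := {ffun 'I_n -> midx k d}.

Notation tpower R k d n := (cvec R (pidx k d n)).

Definition tens_pow (R : realType) k d (n : nat) (psi : tensor R k d) :
    tpower R k d n :=
  [ffun x : pidx k d n => \prod_a (psi (x a) : R[i])].

Definition permute_legs k d n (S : {set 'I_k}) (s : 'S_n) (x : pidx k d n) :
    pidx k d n :=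
  [ffun a => [ffun j => if j \in S then x (s a) j else x a j]].

(* S_n permuting the factors of V_S^(x)n and fixing those of V_(~S)^(x)n.  The
   inverse makes this a left action, products in 'S_n being composed from left
   to right. *)
Definition leg_act (R : realType) k d n (S : {set 'I_k}) (s : 'S_n)
    (Phi : tpower R k d n) : tpower R k d n :=
  [ffun x : pidx k d n => Phi (permute_legs S (s^-1)%g x)].

(* f restricts to a homomorphism of S_n-modules on the Specht module *)
Definition specht_hom (R : realType) k d n (S : {set 'I_k}) (lambda : seq nat)
    (f : 'Hom(group_alg R n, tpower R k d n)) : Prop :=
  forall (s : 'S_n) (x : group_alg R n),
    x \in specht R n lambda -> f (ga_act s x) = leg_act S s (f x).

(* The sum of all homomorphic images of the Specht module; the nonzero ones are
   exactly the submodules isomorphic to it. *)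
Definition isotypic (R : realType) k d n (S : {set 'I_k}) (lambda : seq nat) :
    set (tpower R k d n) :=
  [set Phi | exists fs : seq 'Hom(group_alg R n, tpower R k d n),
    (forall f, f \in fs -> specht_hom S lambda f) /\
    Phi \in (\sum_(f <- fs) f @: specht R n lambda)%VS].

Definition symmetric (R : realType) k d n : set (tpower R k d n) :=
  [set Phi | forall s : 'S_n, leg_act [set: 'I_k]%SET s Phi = Phi].

(* Orthogonal projection onto X, meant for a linear subspace X *)
Definition oproj (R : realType) (T : finType) (X : set (cvec R T))
    (v : cvec R T) : cvec R T :=
  xget 0 [set u | X u /\ forall w, X w -> inner (v - u) w = 0].

Definition isotypic_proj (R : realType) k d n (S : {set 'I_k})
    (lambda : seq nat) (Phi : tpower R k d n) : tpower R k d n :=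
  oproj (isotypic S lambda) Phi.

Definition bip_proj (R : realType) k d n (b : bipartition k)
    (lambda : seq nat) (Phi : tpower R k d n) : tpower R k d n :=
  isotypic_proj (bip_side b) lambda (oproj (@symmetric R k d n) Phi).

(* The composite of the projectors over the support.  They commute when the
   support is laminar, so the order of enumeration does not matter. *)
Definition supp_proj (R : realType) k d n (theta : {ffun bipartition k -> R})
    (lambda : bipartition k -> seq nat) (Phi : tpower R k d n) :
    tpower R k d n :=
  foldr (fun b => bip_proj b (lambda b)) Phi (enum (bip_supp theta)).

Definition upper_functional (R : realType) k d
    (theta : {ffun bipartition k -> R}) (psi : tensor R k d) : \bar R :=
  ereal_sup [set h : \bar R |
    exists (n : nat) (lambda : bipartition k -> seq nat),
    [/\ (1 <= n)%N,
        {in bip_supp theta, forall b, is_part n (lambda b)},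
        supp_proj theta lambda (tens_pow n psi) != 0 &
        h = (\sum_(b in bip_supp theta)
               theta b * shannon [seq l%:R / n%:R | l <- lambda b])%:E]].

Definition legA : 'I_4 := @Ordinal 4 0 isT.
Definition legB : 'I_4 := @Ordinal 4 1 isT.
Definition legC : 'I_4 := @Ordinal 4 2 isT.
Definition legD : 'I_4 := @Ordinal 4 3 isT.

Lemma AB_CD_subproof :
  is_bipartition [set [set legA; legB]; [set legC; legD]]%SET.
Proof.
apply/existsP; exists [set legA; legB]%SET; apply/and3P; split.
- by apply/finset.set0Pn; exists legA; rewrite !inE.
- apply/eqP => /finset.setP /(_ legC); by rewrite !inE.
- apply/eqP; congr [set _; _]%SET; apply/finset.setP => j; rewrite !inE.
  by case: j => [[|[|[|[|]]]] ?].
Qed.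

Definition AB_CD : bipartition 4 := Sub _ AB_CD_subproof.

Definition e1 : 'I_2 := @Ordinal 2 0 isT.
Definition e2 : 'I_2 := @Ordinal 2 1 isT.

Definition S_tensor (R : realType) (p : R) : tensor R 4 2 :=
  (Num.sqrt (p / 2))%:C *:
    (etens R [tuple e1; e1; e1; e1] + etens R [tuple e2; e2; e2; e2])
  + (Num.sqrt ((1 - p) / 2))%:C *:
    (etens R [tuple e1; e2; e1; e2] + etens R [tuple e2; e1; e2; e1]).

(* Main.v *)
Require Import Defs.
From HB Require Import structures.
From mathcomp Require Import all_boot all_order all_algebra all_fingroup.
From mathcomp Require Import spectral.
From mathcomp Require Import all_classical all_reals all_analysis.
From mathcomp Require Import complex.
From mathcomp Require Import ring lra.

Set Implicit Arguments.
Unset Strict Implicit.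
Unset Printing Implicit Defensive.

Import Order.TTheory GRing.Theory Num.Theory.

Local Open Scope complex_scope.
Local Open Scope sesquilinear_scope.
Local Open Scope ring_scope.

(** The support of [theta] consists of AB|CD and of bipartitions separating one
    leg from the other three, since these are the only ones laminar with AB|CD.
    A one-leg bipartition has entropy at most 1 and AB|CD at most 2, so both
    functionals are at most [1 + theta AB_CD].  The upper functional attains this
    value, the lower one stays away from it.

    Upper functional ([upper_functional_ge]).  Four copies suffice, with the
    column shape 1111 for AB|CD and the square shape 22 for the other
    bipartitions.  By [inner_supp_proj] a composite of orthogonal projections
    does not annihilate the fourth power of [S_p] as soon as some vector
    [test_vector] is fixed by all of them and is not orthogonal to that power.
    The determinant forms of AB and CD, multiplied together, give such a vector.
    It is a sign vector for the permutations of AB, which is the shape 1111.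
    Inside the fourth exterior power of AB, the permutations of leg A alone act
    through shapes with at most two rows whose transpose also has at most two
    rows, and 22 is the only one: here this is the explicit identity
    [young22_sum].  The inner product with the power of [S_p] is a sum of
    nonnegative terms ([inner_S_tensor_test_vector]), because the flattening of
    [S_p] along AB|CD is diagonal with positive entries.

    Lower functional ([lower_functional_le]).  Local invertible maps rescale two
    polynomials: the bilinear pairing given by the product of the area forms of
    the legs, of degree 2, by the product [D] of the determinants, and the
    determinant of the flattening along AB|CD, of degree 4, by [D ^+ 2].  On
    [S_p] they equal 1 and [p (1 - p) / 4].  The pairing of a unit vector is at
    most 1 in absolute value, so at every unit vector proportional to a point
    of the orbit the flattening has a determinant of absolute value at most
    [p (1 - p) / 4], whereas the uniform spectrum that
    entropy 2 requires would give 1/16.  For [p] different from 1/2 the product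
    of the four eigenvalues is thus bounded away from its value at the uniform
    spectrum, and so is the entropy from 2 ([shannon_gap]). *)

(** * Shannon entropy of a finite distribution *)

Lemma shannon_image (R : realType) (I : finType) (x : I -> R) :
  shannon [seq x i | i : I] = (- \sum_i x i * ln (x i)) / ln 2.
Proof.
rewrite /shannon big_map big_enum /= mulNr mulr_suml; congr (- _).
by apply: eq_bigr => i _; rewrite /log2 mulrA.
Qed.

Lemma ln2_gt0 (R : realType) : 0 < ln (2 : R).
Proof. by rewrite ln_gt0 // ltr1n. Qed.

Lemma ln_ge_1BV (R : realType) (y : R) : 0 < y -> 1 - y^-1 <= ln y.
Proof.
move=> y0; have := @le_ln1Dx R (y^-1 - 1).
rewrite subrKC lnV ?posrE // => /(_ _); rewrite -opprB lerN2; apply.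
by have := y0; rewrite -invr_gt0; lra.
Qed.

(** Gibbs' inequality against the uniform distribution on [r] points. *)
Lemma shannon_le_support (R : realType) (I : finType) (x : I -> R) (r : nat) :
  (forall i, 0 <= x i) -> \sum_i x i = 1 -> (0 < r)%N ->
  (#|[pred i | x i != 0%R]| <= r)%N ->
  shannon [seq x i | i : I] <= log2 r%:R.
Proof.
move=> x0 x1 r0 cr; rewrite shannon_image /log2 ler_pM2r ?invr_gt0 ?ln2_gt0 //.
have r0R : 0 < r%:R :> R by rewrite ltr0n.
suff : - \sum_i x i * ln (x i) <=
    \sum_i (x i * ln r%:R + ((x i != 0)%:R / r%:R - x i)).
  move=> /le_trans; apply; rewrite big_split /= -mulr_suml x1 mul1r sumrB x1.
  rewrite -mulr_suml -natr_sum gerDl subr_le0 ler_pdivrMr // mul1r ler_nat.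
  by rewrite (leq_trans _ cr) // -sum1_card [leqRHS]big_mkcond.
rewrite -sumrN ler_sum // => i _; have := x0 i.
rewrite le_eqVlt => /predU1P[<-|xi0].
  by rewrite eqxx !mul0r subrr addr0 oppr0.
have := @ln_ge_1BV R (r%:R * x i) (mulr_gt0 r0R xi0).
rewrite lnM ?posrE // => /(ler_wpM2l (ltW xi0)).
rewrite mulrBr mulr1 mulrDr invfM mulrCA mulfV ?gt_eqF //= mulr1 mul1r; lra.
Qed.

(** Since [ln y = 2 ln (sqrt y)], the inequality [ln z >= 1 - 1/z] improves
    [y ln y >= y - 1] by a square that vanishes only at [y = 1]. *)
Lemma xlnx_ge (R : realType) (y : R) : 0 <= y ->
  (y - 1) + (Num.sqrt y - 1) ^+ 2 <= y * ln y.
Proof.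
rewrite le_eqVlt => /predU1P[<-|y0]; first by rewrite sqrtr0 mul0r; lra.
set z := Num.sqrt y; have z0 : 0 < z by rewrite sqrtr_gt0.
have zz : y = z ^+ 2 by rewrite sqr_sqrtr // ltW.
have := ler_wpM2l (ltW z0) (ln_ge_1BV z0).
rewrite mulrBr mulr1 mulfV ?gt_eqF // => h.
rewrite zz lnXn // mulr2n.
suff : 0 <= z * (z * ln z - (z - 1)) by lra.
by rewrite mulr_ge0 ?(ltW z0) // subr_ge0.
Qed.

Lemma prod_ge_1BM (R : realType) (I : finType) (y : I -> R) (h : R) :
  0 <= h <= 1 -> (forall i, 1 - h <= y i) ->
  1 - #|I|%:R * h <= \prod_i y i.
Proof.
move=> /andP[h0 h1] yh; apply: (@le_trans _ _ (\prod_(i : I) (1 - h))); last first.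
  by apply: ler_prod => i _; rewrite yh subr_ge0 h1.
rewrite prodr_const; elim: #|I| => [|n IH]; first by rewrite mul0r subr0 expr0.
rewrite exprS; apply: le_trans (ler_wpM2l _ IH); last by rewrite subr_ge0.
by rewrite -natr1; have := mulr_ge0 (ler0n R n) (sqr_ge0 h); lra.
Qed.

(** The product of the rescaled probabilities [n x i] is at most 1, with
    equality only at the uniform distribution.  Bounding it away from 1 forces
    one of the [n x i] away from 1, and by [xlnx_ge] this costs a fixed amount of
    entropy. *)
Lemma shannon_gap (R : realType) (n : nat) (c : R) : (0 < n)%N -> 0 <= c < 1 ->
  exists2 eps : R, 0 < eps & forall x : 'I_n -> R,
    (forall i, 0 <= x i) -> \sum_i x i = 1 -> \prod_i (n%:R * x i) <= c ->
    shannon [seq x i | i : 'I_n] <= log2 n%:R - eps.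
Proof.
move=> n0 /andP[c0 c1]; have n0R : 0 < n%:R :> R by rewrite ltr0n.
(* n (2 eta) is half of 1 - c, so if every n x i were at least 1 - 2 eta, their
   product would exceed c *)
pose eta := (1 - c) / (4 * n%:R).
have eta0 : 0 < eta by rewrite divr_gt0 ?subr_gt0 ?mulr_gt0.
have etan : n%:R * (2 * eta) = (1 - c) / 2.
  by rewrite /eta; field; rewrite gt_eqF.
have n1R : 1 <= n%:R :> R by rewrite ler1n.
have eta1 : 2 * eta <= 1.
  rewrite (le_trans (ler_peMl _ n1R)) ?etan ?mulr_ge0 ?(ltW eta0) //; lra.
exists (eta ^+ 2 / n%:R / ln 2).
  by rewrite !divr_gt0 ?exprn_gt0 ?ln2_gt0.
move=> x x0 x1 xc; pose y i := n%:R * x i.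
have y0 i : 0 <= y i by rewrite mulr_ge0 // ltW.
have [i yi] : exists i, y i < 1 - 2 * eta.
  apply: contrapT => /forallNP H.
  have := @prod_ge_1BM R _ y (2 * eta); rewrite card_ord etan => /(_ _ _).
  move=> h; have {h} : 1 - (1 - c) / 2 <= \prod_i y i.
    apply: h => [|i]; first by rewrite eta1 mulr_ge0 // ltW.
    by rewrite leNgt; apply/negP/H.
  by rewrite leNgt => /negP; apply; apply: le_lt_trans xc _; lra.
have sq : eta ^+ 2 <= (Num.sqrt (y i) - 1) ^+ 2.
  have : Num.sqrt (y i) <= 1 - eta.
    rewrite -[leRHS]ger0_norm -?sqrtr_sqr ?ler_wsqrtr //; last lra.
    by have := sqr_ge0 eta; lra.
  by move=> h; rewrite -[leRHS]sqrrN; apply: lerXn2r; rewrite ?nnegrE; lra.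
have key : eta ^+ 2 <= \sum_i y i * ln (y i).
  apply: (le_trans sq).
  apply: (@le_trans _ _ (\sum_i ((y i - 1) + (Num.sqrt (y i) - 1) ^+ 2))).
    rewrite big_split /= sumrB -mulr_sumr x1 sumr_const card_ord mulr1 subrr.
    by rewrite add0r (bigD1 i) //= lerDl sumr_ge0 // => j _; apply: sqr_ge0.
  by apply: ler_sum => j _; apply: xlnx_ge.
have split_y : \sum_i y i * ln (y i) =
    n%:R * (ln n%:R + \sum_i x i * ln (x i)).
  have -> : ln n%:R = \sum_i x i * ln n%:R by rewrite -mulr_suml x1 mul1r.
  rewrite -big_split mulr_sumr /=.
  apply: eq_bigr => j _; rewrite /y; have := x0 j.
  rewrite le_eqVlt => /predU1P[<-|xj]; first by rewrite !(mulr0, mul0r, addr0).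
  by rewrite lnM ?posrE //; ring.
rewrite shannon_image /log2 -mulrBl ler_pM2r ?invr_gt0 ?ln2_gt0 //.
suff : eta ^+ 2 / n%:R <= ln n%:R + \sum_i x i * ln (x i) by lra.
by rewrite ler_pdivrMr // mulrC -split_y.
Qed.

(** * Orthogonal projection onto a subspace *)

Section InnerProduct.
Variables (R : realType) (T : finType).
Implicit Types u v w : cvec R T.

Fact inner_bilinear : bilinear_for (GRing.Scale.Law.clone _ _ ( *%R ) _)
  (GRing.Scale.Law.clone _ _ (Num.conj \; *%R ) _) (@inner R T).
Proof.
split=> [w a u v|u a v w] /=; rewrite /inner mulr_sumr -big_split /=;
  apply: eq_bigr => x _; rewrite !ffunE.
- by rewrite mulrDl -mulrA.
- by rewrite rmorphD rmorphM mulrDr mulrCA.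
Qed.

HB.instance Definition _ := bilinear_isBilinear.Build (R[i]) _ _ _ _ _
  (@inner R T) inner_bilinear.

Fact inner_hermitian u v : inner u v = (-1) ^+ false * Num.conj (inner v u).
Proof.
rewrite expr0 mul1r /inner rmorph_sum; apply: eq_bigr => x _.
by rewrite rmorphM /= conjCK mulrC.
Qed.

HB.instance Definition _ :=
  isHermitianSesquilinear.Build _ _ _ _ (@inner R T) inner_hermitian.

Lemma inner_norm u : inner u u = \sum_x `|u x : R[i]| ^+ 2.
Proof. by apply: eq_bigr => x _; rewrite normCK. Qed.

Lemma inner_ge0 u : 0 <= inner u u.
Proof. by rewrite inner_norm sumr_ge0 // => x _; apply: exprn_ge0. Qed.

Fact inner_gt0 u : u != 0 -> 0 < inner u u.
Proof.
rewrite inner_norm => un0.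
have sum_ge0 : forall x, true -> 0 <= `|u x : R[i]| ^+ 2.
  by move=> x _; apply: exprn_ge0.
rewrite lt0r sumr_ge0 // andbT; apply: contra un0 => /eqP/psumr_eq0P H.
apply/eqP/ffunP => x; rewrite ffunE; apply/eqP.
by have /eqP := H sum_ge0 x isT; rewrite sqrf_eq0 normr_eq0.
Qed.

HB.instance Definition _ := isDotProduct.Build _ _ (@inner R T) inner_gt0.

(** A linear subspace given as a set is a finite-dimensional space: any subspace
    of maximal dimension contained in it exhausts it. *)
Lemma linear_set_vspace (X : set (cvec R T)) :
  X 0 -> (forall a u v, X u -> X v -> X (a *: u + v)) ->
  exists U : {vspace cvec R T}, forall u, X u <-> u \in U.
Proof.
move=> X0 Xlin.
pose P n := `[< exists2 U : {vspace cvec R T},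
                 (forall u, u \in U -> X u) & \dim U = n >].
have exP : exists n, P n.
  exists 0%N; apply/asboolP; exists 0%VS; last by rewrite dimv0.
  by move=> u; rewrite memv0 => /eqP ->.
have ubP n : P n -> (n <= \dim {: cvec R T})%N.
  by move=> /asboolP[U _ <-]; apply: dimvS; apply: subvf.
case: (ex_maxnP exP ubP) => n /asboolP[U UX dimU] maxn.
exists U => u; split=> [Xu|/UX//].
have : P (\dim (<[u]> + U)%VS).
  apply/asboolP; exists (<[u]> + U)%VS => // w /memv_addP[_ /vlineP[a ->] [v vU ->]].
  exact/Xlin/UX.
move=> /maxn; rewrite -dimU => dimle.
have : (U == (<[u]> + U)%VS) by rewrite eqEdim addvSr.
by move=> /eqP ->; apply: (subvP (addvSl _ _)); apply: memv_line.
Qed.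

(** This is what makes [oproj X] self-adjoint: [X] being linear, the orthogonal
    projection that defines it exists. *)
Lemma inner_oproj (X : set (cvec R T)) v w :
  X 0 -> (forall a u v, X u -> X v -> X (a *: u + v)) -> X w ->
  inner (oproj X v) w = inner v w.
Proof.
move=> X0 Xlin Xw; have [U UP] := linear_set_vspace X0 Xlin.
rewrite /oproj; case: xgetP => [u _ [_ /(_ w Xw)]|noproj].
  by rewrite linearBl /= => /eqP; rewrite subr_eq0 => /eqP.
have [u uU [y [def_v _ yU]]] := orthogonal_split (@inner R T) (vbasis U) v.
case: (noproj u); split; first by apply/UP; rewrite -[U](span_basis (vbasisP U)).
move=> x /UP xU; rewrite def_v addrC addKr.
by apply: (span_orthogonal yU); rewrite ?memv_span1 ?(span_basis (vbasisP U)).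
Qed.

End InnerProduct.

(** * Spectrum of a Gram matrix *)

(** The nonzero entries form an invertible principal submatrix. *)
Lemma card_support_le_rank (K : fieldType) n (d : 'rV[K]_n) :
  (#|[pred i | d ord0 i != 0%R]| <= \rank (diag_mx d))%N.
Proof.
set A := [pred i | _]; pose e : 'I_#|A| -> 'I_n := enum_val.
have e_inj : injective e by apply: enum_val_inj.
pose M := mxsub e e (diag_mx d).
have MU : M \in unitmx.
  have -> : M = diag_mx (\row_k d ord0 (e k)).
    by apply/matrixP => i j; rewrite !mxE (inj_eq e_inj).
  rewrite unitmxE det_diag unitfE; apply/prodf_neq0 => k _.
  by rewrite mxE; have := enum_valP k; rewrite inE.
rewrite -(mxrank_unit MU) /M.
have -> : mxsub e e (diag_mx d) =
    rowsub e 1%:M *m diag_mx d *m colsub e 1%:M.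
  by rewrite -rowsubE mulmx_colsub mulmx1 -mxsub_comp.
by apply: (leq_trans (mxrankM_maxl _ _)); apply: mxrankM_maxr.
Qed.

Section GramSpectrum.
Variables (R : realType) (m n : nat) (F : 'M[R[i]]_(m, n)) (c : R[i]).
Hypotheses (c_ge0 : 0 <= c) (c_norm : c * \tr (F *m F^t* ) = 1).

Let rho := c *: (F *m F^t* ).
Let x k : R := complex.Re (spectral_diag rho ord0 k).
Let P := spectralmx rho.

(** A unitary change of basis turns a Gram matrix into the Gram matrix of the
    transformed rows, so the eigenvalues are rescaled squared norms of rows. *)
Lemma gram_diagonal : diag_mx (spectral_diag rho) = c *: (P *m F *m (P *m F)^t* ).
Proof.
have rhoH : rho \is hermsymmx.
  apply/is_hermitianmxP; rewrite expr0 scale1r; apply/matrixP => i j.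
  rewrite !mxE rmorphM /= geC0_conj // rmorph_sum; congr (_ * _).
  by apply: eq_bigr => k _; rewrite !mxE rmorphM /= conjCK mulrC.
have PU : P \is unitarymx by apply: spectral_unitarymx.
have Pu : P \in unitmx by apply: unitarymx_unit.
have rhoE : rho = invmx P *m diag_mx (spectral_diag rho) *m P.
  by apply/orthomx_spectralP/hermitian_normalmx.
have -> : diag_mx (spectral_diag rho) = P *m rho *m invmx P.
  by rewrite rhoE !mulmxA mulmxV // mul1mx mulmxK // -rhoE.
rewrite invmx_unitary // /rho -scalemxAr -scalemxAl.
by rewrite trmx_mul map_mxM !mulmxA.
Qed.

Lemma gram_eigenvalueE k : spectral_diag rho ord0 k = (x k)%:C.
Proof.
rewrite /x RRe_real // ger0_real //.
have /matrixP/(_ k k) := gram_diagonal; rewrite !mxE eqxx mulr1n => ->.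
rewrite mulr_ge0 // sumr_ge0 // => j _.
by rewrite !mxE mul_conjC_ge0.
Qed.

Lemma gram_eigenvalue_ge0 k : 0 <= x k.
Proof.
rewrite -ler0c -gram_eigenvalueE.
have /matrixP/(_ k k) := gram_diagonal; rewrite !mxE eqxx mulr1n => ->.
rewrite mulr_ge0 // sumr_ge0 // => j _.
by rewrite !mxE mul_conjC_ge0.
Qed.

Lemma gram_conj : rho = invmx P *m diag_mx (spectral_diag rho) *m P.
Proof.
have PU : P \in unitmx by rewrite unitarymx_unit // spectral_unitarymx.
rewrite gram_diagonal trmx_mul map_mxM -invmx_unitary ?spectral_unitarymx //.
by rewrite -scalemxAr -scalemxAl !mulmxA mulVmx // mul1mx mulmxKV.
Qed.

Lemma gram_eigenvalue_sum : \sum_k x k = 1.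
Proof.
apply: (fmorph_inj (@real_complex R)); rewrite rmorph_sum rmorph1 -c_norm.
rewrite -mxtraceZ -/rho gram_conj mxtrace_mulC mulmxA mulmxV; last first.
  by rewrite unitarymx_unit // spectral_unitarymx.
rewrite mul1mx mxtrace_diag; apply: eq_bigr => k _.
by rewrite gram_eigenvalueE.
Qed.

Lemma gram_eigenvalue_prod : (\prod_k x k)%:C = \det rho.
Proof.
rewrite [in RHS]gram_conj !det_mulmx mulrAC -det_mulmx mulVmx; last first.
  by rewrite unitarymx_unit // spectral_unitarymx.
rewrite det1 mul1r det_diag rmorph_prod; apply: eq_bigr => k _.
by rewrite gram_eigenvalueE.
Qed.

Lemma gram_eigenvalue_support : (#|[pred k | x k != 0%R]| <= minn m n)%N.
Proof.
have -> : #|[pred k | x k != 0%R]| = #|[pred k | spectral_diag rho ord0 k != 0]|.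
  by apply: eq_card => k; rewrite !inE gram_eigenvalueE fmorph_eq0.
apply: leq_trans (card_support_le_rank _) _; rewrite gram_diagonal.
rewrite leq_min rank_leq_row /= (leq_trans (mxrank_scale _ _)) //.
by rewrite (leq_trans (mxrankM_maxl _ _)) // rank_leq_col.
Qed.

Lemma von_neumann_gram_le (r : nat) : (0 < r)%N -> (minn m n <= r)%N ->
  von_neumann rho <= log2 r%:R.
Proof.
move=> r0 mnr; apply: shannon_le_support => //.
- exact: gram_eigenvalue_ge0.
- exact: gram_eigenvalue_sum.
- exact: leq_trans gram_eigenvalue_support mnr.
Qed.

End GramSpectrum.

(** * Flattenings *)

Section Flattening.
Variables (R : realType) (k d : nat) (S : {set 'I_k}).
Implicit Type psi : tensor R k d.

Definition flat_index (x : midx k d) :=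
  (enum_rank (restr S x), enum_rank (restr (finset.setC S) x)).

Lemma flat_index_inj : injective flat_index.
Proof.
move=> x y [/enum_rank_inj exy /enum_rank_inj exy']; apply/ffunP => j.
case: (boolP (j \in S)) => jS.
  by have /ffunP/(_ (exist _ j jS)) := exy; rewrite !ffunE.
have jS' : j \in finset.setC S by rewrite inE.
by have /ffunP/(_ (exist _ j jS')) := exy'; rewrite !ffunE.
Qed.

Lemma card_sub_midx (T : {set 'I_k}) : #|{: sub_midx d T}| = (d ^ #|T|)%N.
Proof. by rewrite card_ffun card_ord card_sig; congr (d ^ _)%N; apply: eq_card. Qed.

Lemma flat_index_bij : bijective flat_index.
Proof.
apply: inj_card_bij; first exact: flat_index_inj.
rewrite card_prod !card_ord !card_sub_midx -expnD cardsC card_ffun !card_ord.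
exact: leqnn.
Qed.

Lemma flatteningE psi x :
  flattening S psi (flat_index x).1 (flat_index x).2 = psi x.
Proof.
rewrite /flattening summxE (bigD1 x) //= big1 => [|y yx].
  by rewrite !mxE !eqxx mulr1 addr0.
rewrite !mxE; case: andP => [[/eqP e1 /eqP e2]|]; last by rewrite mulr0.
by case/eqP: yx; apply: flat_index_inj; rewrite /flat_index e1 e2.
Qed.

Lemma inner_flattening psi :
  inner psi psi = \tr (flattening S psi *m (flattening S psi)^t* ).
Proof.
set F := flattening S psi.
transitivity (\sum_(ij : 'I_#|{: sub_midx d S}| *
                         'I_#|{: sub_midx d (finset.setC S)}|)
    F ij.1 ij.2 * Num.conj (F ij.1 ij.2)).
  rewrite (reindex flat_index) /=; last by apply/onW_bij/flat_index_bij.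
  by apply: eq_bigr => x _; rewrite flatteningE.
rewrite -(pair_bigA _ (fun i j => F i j * Num.conj (F i j))) /=.
by apply: eq_bigr => i _; rewrite mxE; apply: eq_bigr => j _; rewrite !mxE.
Qed.

Lemma density_trace psi : inner psi psi != 0 ->
  (inner psi psi)^-1 * \tr (flattening S psi *m (flattening S psi)^t* ) = 1.
Proof. by move=> h; rewrite -inner_flattening mulVf. Qed.

End Flattening.

Lemma bip_entropy_le (R : realType) k d (b : bipartition k) (psi : tensor R k d)
    (r : nat) : inner psi psi != 0 -> (0 < r)%N ->
  (minn (d ^ #|bip_side b|) (d ^ #|finset.setC (bip_side b)|) <= r)%N ->
  bip_entropy b psi <= log2 r%:R.
Proof.
move=> psi0 r0; rewrite -!card_sub_midx => hr.
apply: von_neumann_gram_le r0 hr; last exact: density_trace.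
by rewrite invr_ge0 inner_ge0.
Qed.

(** The index types of a flattening have the right cardinal only up to a
    propositional equality, and their enumeration is opaque; the Gram determinant
    does not see the enumeration, which can only change the sign of the
    determinant of [F]. *)
Lemma det_gram_reindex (C : numClosedFieldType) q m n (F : 'M[C]_(m, n))
    (G : 'M[C]_q) (f : 'I_q -> 'I_m) (g : 'I_q -> 'I_n) :
  m = q -> n = q -> injective f -> injective g ->
  (forall i j, F (f i) (g j) = G i j) ->
  \det (F *m F^t* ) = `|\det G| ^+ 2.
Proof.
move=> mq nq; subst m n => f_inj g_inj FG.
have -> : G = perm_mx (perm f_inj) *m F *m perm_mx (perm g_inj)^-1%g.
  by rewrite -row_permE -col_permE; apply/matrixP => i j; rewrite !mxE !permE FG.
rewrite !det_mulmx !det_perm !normrM !normr_sign mul1r mulr1 normCK.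
by rewrite det_map_mx det_tr.
Qed.

(** * The flattening along AB|CD *)

Lemma big_legs (T : Type) (idx : T) (op : Monoid.law idx) (F : 'I_4 -> T) :
  \big[op/idx]_(l < 4) F l = op (F legA) (op (F legB) (op (F legC) (F legD))).
Proof.
rewrite !big_ord_recl big_ord0 Monoid.mulm1.
by congr (op (F _) (op (F _) (op (F _) (F _)))); apply: val_inj.
Qed.

Definition bit (i : nat) : 'I_2 := if odd i then e2 else e1.

(** Rows and columns of the flattening along AB|CD are numbered in binary. *)
Definition bits_midx (i j : nat) : midx 4 2 :=
  [ffun l => tnth [tuple bit i./2; bit i; bit j./2; bit j] l].

Lemma bits_inj (i j : 'I_4) : bit i./2 = bit j./2 -> bit i = bit j -> i = j.
Proof.
move=> h1 h2; apply: val_inj; move: h1 h2.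
by case: i => [[|[|[|[|?]]]] ?] //; case: j => [[|[|[|[|?]]]] ?].
Qed.

Lemma bits_midx_bij : bijective (fun ij : 'I_4 * 'I_4 => bits_midx ij.1 ij.2).
Proof.
apply: inj_card_bij; last by rewrite card_prod card_ffun !card_ord.
move=> [i j] [i' j'] /= /ffunP H.
have hA := H legA; have hB := H legB; have hC := H legC; have hD := H legD.
rewrite !ffunE /tnth /= in hA hB hC hD.
by congr pair; apply: bits_inj.
Qed.

(** The flattening along AB|CD as a square matrix of fixed size, its determinant
    being a polynomial on tensors. *)
Definition AB_CD_mx (R : realType) (psi : tensor R 4 2) : 'M[R[i]]_4 :=
  \matrix_(i, j) psi (bits_midx i j).

Definition kron (C : comPzRingType) (A B : 'M[C]_2) : 'M[C]_4 :=
  \matrix_(i, j) (A (bit i./2) (bit j./2) * B (bit i) (bit j)).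

(** Entries indexed by numbers keep this shape when a row and a column are
    removed, so that the expansion can be iterated. *)
Lemma det_row0 (C : comPzRingType) n (a : nat -> nat -> C) :
  \det (\matrix_(i < n.+1, j < n.+1) a i j) =
  \sum_(j < n.+1) (-1) ^+ j * a 0%N j *
    \det (\matrix_(i < n, l < n) a i.+1 (bump j l)).
Proof.
rewrite (expand_det_row _ ord0); apply: eq_bigr => j _.
rewrite /cofactor !mxE mulrCA mulrA add0n; congr (_ * \det _).
by apply/matrixP => i l; rewrite !mxE.
Qed.

Lemma det2E (C : comPzRingType) (a : nat -> nat -> C) :
  \det (\matrix_(i < 2, j < 2) a i j) =
  a 0%N 0%N * a 1%N 1%N - a 0%N 1%N * a 1%N 0%N.
Proof.
rewrite (det_row0 1) !big_ord_recl big_ord0 !det_mx11 !mxE /=.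
rewrite /bump /=; ring.
Qed.

Lemma det3E (C : comPzRingType) (a : nat -> nat -> C) :
  \det (\matrix_(i < 3, j < 3) a i j) =
  a 0%N 0%N * (a 1%N 1%N * a 2%N 2%N - a 1%N 2%N * a 2%N 1%N)
  - a 0%N 1%N * (a 1%N 0%N * a 2%N 2%N - a 1%N 2%N * a 2%N 0%N)
  + a 0%N 2%N * (a 1%N 0%N * a 2%N 1%N - a 1%N 1%N * a 2%N 0%N).
Proof.
rewrite (det_row0 2) !big_ord_recl big_ord0.
rewrite !(det2E (fun i l => a i.+1 (bump _ l))) /bump /=; ring.
Qed.

Lemma det4E (C : comPzRingType) (a : nat -> nat -> C) :
  \det (\matrix_(i < 4, j < 4) a i j) =
  let minor j1 j2 j3 :=
    a 1%N j1 * (a 2%N j2 * a 3%N j3 - a 2%N j3 * a 3%N j2)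
    - a 1%N j2 * (a 2%N j1 * a 3%N j3 - a 2%N j3 * a 3%N j1)
    + a 1%N j3 * (a 2%N j1 * a 3%N j2 - a 2%N j2 * a 3%N j1) in
  a 0%N 0%N * minor 1%N 2%N 3%N - a 0%N 1%N * minor 0%N 2%N 3%N
  + a 0%N 2%N * minor 0%N 1%N 3%N - a 0%N 3%N * minor 0%N 1%N 2%N.
Proof.
rewrite (det_row0 3) !big_ord_recl big_ord0.
rewrite !(det3E (fun i l => a i.+1 (bump _ l))) /bump /=; ring.
Qed.

Lemma det_mx22 (C : comPzRingType) (A : 'M[C]_2) :
  \det A = A e1 e1 * A e2 e2 - A e1 e2 * A e2 e1.
Proof.
have -> : A = \matrix_(i < 2, j < 2) A (bit i) (bit j).
  apply/matrixP => i j; rewrite mxE; congr (A _ _); apply: val_inj.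
    by case: i => [[|[|?]] ?].
  by case: j => [[|[|?]] ?].
by rewrite (det2E (fun i j => A (bit i) (bit j))) !mxE.
Qed.

(** The exponent 2 is the size of the other factor. *)
Lemma det_kron (C : comPzRingType) (A B : 'M[C]_2) :
  \det (kron A B) = (\det A * \det B) ^+ 2.
Proof.
rewrite (det4E (fun i j => A (bit i./2) (bit j./2) * B (bit i) (bit j))) /=.
rewrite !det_mx22 /bit /=; ring.
Qed.

Lemma AB_CD_mx_local_act (R : realType) (A : 'I_4 -> 'M[R[i]]_2) (psi : tensor R 4 2) :
  AB_CD_mx (local_act A psi) =
  kron (A legA) (A legB) *m AB_CD_mx psi *m (kron (A legC) (A legD))^T.
Proof.
apply/matrixP => i j; rewrite !mxE ffunE.
rewrite (reindex (fun ij : 'I_4 * 'I_4 => bits_midx ij.1 ij.2)) /=;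
  last exact/onW_bij/bits_midx_bij.
rewrite -(pair_bigA _ (fun i' j' : 'I_4 =>
   (\prod_l A l (bits_midx i j l) (bits_midx i' j' l)) * psi (bits_midx i' j'))) /=.
rewrite exchange_big /=.
apply: eq_bigr => j' _; rewrite !mxE mulr_suml; apply: eq_bigr => i' _.
rewrite big_legs !mxE !ffunE /tnth /=; ring.
Qed.

Lemma det_AB_CD_local_act (R : realType) (A : 'I_4 -> 'M[R[i]]_2) (psi : tensor R 4 2) :
  \det (AB_CD_mx (local_act A psi)) =
  (\prod_l \det (A l)) ^+ 2 * \det (AB_CD_mx psi).
Proof.
rewrite AB_CD_mx_local_act !det_mulmx det_tr !det_kron big_legs /=; ring.
Qed.

(** * Two polynomials that local maps rescale *)

Lemma ord2_case (i : 'I_2) : i = e1 \/ i = e2.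
Proof. by case: i => [[|[|?]] ?]; [left|right|]; try exact: val_inj. Qed.

Section Pairing.
Variables (R : realType) (k : nat).
Implicit Types (psi : tensor R k 2) (x y : midx k 2).

(** The area form of the plane: 1 at [(e1, e2)], -1 at [(e2, e1)]. *)
Definition area (s t : 'I_2) : R[i] := t%:R - s%:R.

(** Each leg contributes its area form, which a matrix multiplies by its
    determinant. *)
Definition pairing psi : R[i] :=
  \sum_(x : midx k 2) \sum_(y : midx k 2)
    (\prod_l area (x l) (y l)) * ((psi x : R[i]) * psi y).

Lemma area_mx (A : 'M[R[i]]_2) (u v : 'I_2) :
  \sum_s \sum_t area s t * (A s u * A t v) = \det A * area u v.
Proof.
rewrite det_mx22 !big_ord_recl !big_ord0 /area.
have -> : lift ord0 ord0 = e2 :> 'I_2 by apply: val_inj.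
have -> : ord0 = e1 :> 'I_2 by apply: val_inj.
by have [->|->] := ord2_case u; have [->|->] := ord2_case v; rewrite /=; ring.
Qed.

Lemma sum2_prod (G : 'I_k -> 'I_2 -> 'I_2 -> R[i]) :
  \sum_(x : midx k 2) \sum_(y : midx k 2) \prod_l G l (x l) (y l) =
  \prod_l \sum_s \sum_t G l s t.
Proof.
rewrite bigA_distr_bigA; apply: eq_bigr => x _.
by rewrite bigA_distr_bigA.
Qed.

Lemma sum4_exchange (I : finType) (P a b : I -> I -> R[i]) :
  \sum_x \sum_y P x y * ((\sum_u a x u) * (\sum_v b y v)) =
  \sum_u \sum_v \sum_x \sum_y P x y * (a x u * b y v).
Proof.
transitivity (\sum_x \sum_y \sum_u \sum_v P x y * (a x u * b y v)).
  apply: eq_bigr => x _; apply: eq_bigr => y _; rewrite big_distrlr mulr_sumr /=.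
  by apply: eq_bigr => u _; rewrite mulr_sumr.
under eq_bigr => x _ do rewrite exchange_big /=.
rewrite exchange_big /=; apply: eq_bigr => u _.
by under eq_bigr => x _ do rewrite exchange_big /=; rewrite exchange_big.
Qed.

Lemma pairing_local_act (A : 'I_k -> 'M[R[i]]_2) psi :
  pairing (local_act A psi) = (\prod_l \det (A l)) * pairing psi.
Proof.
transitivity (\sum_(x : midx k 2) \sum_(y : midx k 2)
    (\prod_l area (x l) (y l)) *
    ((\sum_(u : midx k 2) \prod_l A l (x l) (u l) * psi u) *
     (\sum_(v : midx k 2) \prod_l A l (y l) (v l) * psi v))).
  by apply: eq_bigr => x _; apply: eq_bigr => y _; rewrite !ffunE.
rewrite (sum4_exchange (fun x y => \prod_l area (x l) (y l))
  (fun x u => \prod_l A l (x l) (u l) * psi u)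
  (fun y v => \prod_l A l (y l) (v l) * psi v)).
rewrite mulr_sumr; apply: eq_bigr => u _; rewrite mulr_sumr; apply: eq_bigr => v _.
transitivity ((\sum_(x : midx k 2) \sum_(y : midx k 2)
    \prod_l (area (x l) (y l) * (A l (x l) (u l) * A l (y l) (v l)))) *
    ((psi u : R[i]) * psi v)).
  rewrite mulr_suml; apply: eq_bigr => x _; rewrite mulr_suml.
  by apply: eq_bigr => y _; rewrite !big_split /= mulrACA !mulrA.
rewrite (sum2_prod (fun l s t => area s t * (A l s (u l) * A l t (v l)))).
rewrite [RHS]mulrA -big_split /=; congr (_ * _).
by apply: eq_bigr => l _; rewrite area_mx.
Qed.

(** Every index [x] is paired with a single [y], with weight 1 or -1, and the norm of
    [psi x * psi y] is at most the mean of the two squared norms; in the sum every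
    squared norm then occurs twice with coefficient 1/2. *)
Lemma pairing_le_norm psi : `|pairing psi| <= inner psi psi.
Proof.
have area_ge0 x y : 0 <= \prod_l `|area (x l) (y l)| by apply: prodr_ge0.
have area_sum (x : midx k 2) : \sum_(y : midx k 2) \prod_l `|area (x l) (y l)| = 1.
  rewrite -(bigA_distr_bigA (fun l t => `|area (x l) t|)) big1 // => l _.
  rewrite !big_ord_recl big_ord0 /area.
  case: (x l) => [[|[|?]] ?] //=.
    by rewrite subrr normr0 add0r addr0 subr0 normr1.
  by rewrite /bump /= subrr normr0 addr0 sub0r normrN normr1 addr0.
have areaC x y : \prod_l `|area (x l) (y l)| = \prod_l `|area (y l) (x l)|.
  by apply: eq_bigr => l _; rewrite /area distrC.
apply: (@le_trans _ _ (\sum_(x : midx k 2) \sum_(y : midx k 2)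
      (\prod_l `|area (x l) (y l)|) *
    ((`|psi x : R[i]| ^+ 2 + `|psi y : R[i]| ^+ 2) / 2))).
  apply: (le_trans (ler_norm_sum _ _ _)); apply: ler_sum => x _.
  apply: (le_trans (ler_norm_sum _ _ _)); apply: ler_sum => y _.
  rewrite !normrM normr_prod; apply: ler_wpM2l => //.
  rewrite ler_pdivlMr // mulr_natr.
  by case: (real_leif_mean_square_scaled (normr_real (psi x : R[i]))
              (normr_real (psi y : R[i]))).
rewrite inner_norm.
have -> : \sum_x `|psi x : R[i]| ^+ 2 =
    \sum_x `|psi x : R[i]| ^+ 2 / 2 + \sum_x `|psi x : R[i]| ^+ 2 / 2.
  by rewrite -big_split /=; apply: eq_bigr => x _; rewrite -splitr.
under eq_bigr => x _ do under eq_bigr => y _ do rewrite mulrDl mulrDr.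
under eq_bigr => x _ do rewrite big_split /=.
rewrite big_split /= lerD //.
  by apply: ler_sum => x _; rewrite -mulr_suml area_sum mul1r.
rewrite exchange_big /=; apply: ler_sum => x _.
by under eq_bigr => y _ do rewrite areaC; rewrite -mulr_suml area_sum mul1r.
Qed.

End Pairing.

(** * The tensors S_p *)

Section STensor.
Variables (R : realType) (p : R).
Hypothesis p01 : 0 < p < 1.

Definition amplitude (s t : 'I_2) : R :=
  if s == t then Num.sqrt (p / 2) else Num.sqrt ((1 - p) / 2).

Lemma etensE (x : midx 4 2) (a b c d : 'I_2) :
  etens R [tuple a; b; c; d] x =
  ([&& x legA == a, x legB == b, x legC == c & x legD == d]%:R : R[i]).
Proof.
rewrite ffunE; congr ((nat_of_bool _)%:R).
transitivity (\big[andb/true]_(l < 4) (x l == tnth [tuple a; b; c; d] l)).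
  by rewrite big_andE; apply: eq_forallb.
by rewrite big_legs /tnth /=.
Qed.

Lemma S_tensorE (x : midx 4 2) : S_tensor p x =
  (if (x legC == x legA) && (x legD == x legB)
   then (amplitude (x legA) (x legB))%:C else 0) :> R[i].
Proof.
transitivity ((Num.sqrt (p / 2))%:C * ((etens R [tuple e1; e1; e1; e1] x : R[i])
    + etens R [tuple e2; e2; e2; e2] x) + (Num.sqrt ((1 - p) / 2))%:C *
    ((etens R [tuple e1; e2; e1; e2] x : R[i]) + etens R [tuple e2; e1; e2; e1] x)).
  by rewrite !ffunE.
rewrite !etensE /amplitude.
by have [->|->] := ord2_case (x legA); have [->|->] := ord2_case (x legB);
  have [->|->] := ord2_case (x legC); have [->|->] := ord2_case (x legD);
  rewrite /= ?(mulr0, mulr1, addr0, add0r).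
Qed.

Lemma amplitude_gt0 s t : 0 < amplitude s t.
Proof.
have [p0 p1] := andP p01; rewrite /amplitude; case: ifP => _.
  by rewrite sqrtr_gt0 divr_gt0.
by rewrite sqrtr_gt0 divr_gt0 ?subr_gt0.
Qed.

Lemma S_tensor_ge0 (x : midx 4 2) : 0 <= S_tensor p x :> R[i].
Proof.
rewrite S_tensorE; case: ifP => _ //.
by rewrite ler0c ltW // amplitude_gt0.
Qed.

Lemma S_tensor_bits (i j : nat) : S_tensor p (bits_midx i j) =
  (if (bit j./2 == bit i./2) && (bit j == bit i)
   then (amplitude (bit i./2) (bit i))%:C else 0) :> R[i].
Proof. by rewrite S_tensorE !ffunE /tnth /=. Qed.

Lemma sqr_amplitude : (Num.sqrt (p / 2)) ^+ 2 = p / 2 /\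
  (Num.sqrt ((1 - p) / 2)) ^+ 2 = (1 - p) / 2.
Proof. by have [p0 p1] := andP p01; rewrite !sqr_sqrtr //; lra. Qed.

Lemma det_AB_CD_S_tensor :
  \det (AB_CD_mx (S_tensor p)) = (p * (1 - p) / 4)%:C.
Proof.
rewrite (det4E (fun i j => S_tensor p (bits_midx i j) : R[i])) /= !S_tensor_bits /=.
rewrite /amplitude /=; have [a2 b2] := sqr_amplitude.
transitivity ((Num.sqrt (p / 2) ^+ 2 * Num.sqrt ((1 - p) / 2) ^+ 2)%:C).
  by rewrite !expr2 !rmorphM /=; ring.
by rewrite a2 b2; congr (_%:C); field.
Qed.

(** The diagonal entries [i] and [3 - i] are paired; this gives
    [2 (p / 2 + (1 - p) / 2)]. *)
Lemma pairing_S_tensor : pairing (S_tensor p) = 1.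
Proof.
have diag (G : midx 4 2 -> R[i]) :
    \sum_x (S_tensor p x : R[i]) * G x =
    \sum_(i < 4) (amplitude (bit i./2) (bit i))%:C * G (bits_midx i i).
  rewrite (reindex (fun ij : 'I_4 * 'I_4 => bits_midx ij.1 ij.2)) /=;
    last exact/onW_bij/bits_midx_bij.
  rewrite -(pair_bigA _ (fun i j : 'I_4 =>
    (S_tensor p (bits_midx i j) : R[i]) * G (bits_midx i j))) /=.
  apply: eq_bigr => i _; rewrite (bigD1 i) //= big1 => [|j ji].
    by rewrite addr0 S_tensor_bits !eqxx.
  rewrite S_tensor_bits; case: andP => [[/eqP h1 /eqP h2]|]; last by rewrite mul0r.
  by case/eqP: ji; apply: bits_inj.
pose form (x y : midx 4 2) := \prod_l area R (x l) (y l).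
transitivity (\sum_x (S_tensor p x : R[i]) * (\sum_y (S_tensor p y : R[i]) * form x y)).
  apply: eq_bigr => x _; rewrite mulr_sumr; apply: eq_bigr => y _.
  by rewrite mulrC mulrA.
rewrite (diag (fun x => \sum_y (S_tensor p y : R[i]) * form x y)).
under eq_bigr => i _ do rewrite diag.
rewrite !big_ord_recl !big_ord0 /form !big_legs /= !ffunE /tnth /= /bump /=.
rewrite /area /amplitude /= !(subrr, mul0r, mulr0, addr0, add0r, subr0, sub0r).
rewrite !(mulrN1, mulN1r, opprK, mulr1, mul1r).
have [a2 b2] := sqr_amplitude.
transitivity ((2 * (Num.sqrt (p / 2) ^+ 2 + Num.sqrt ((1 - p) / 2) ^+ 2))%:C).
  rewrite !expr2 (rmorphM (real_complex R)) !(rmorphD (real_complex R)).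
  by rewrite !(rmorphM (real_complex R)) /=; ring.
rewrite a2 b2 -[RHS](rmorph1 (@real_complex R)); congr (_%:C); lra.
Qed.

End STensor.

(** * The lower functional stays below the trivial bound *)

Lemma bip_sideP k (b : bipartition k) : bip_side b \in val b.
Proof.
have /existsP[S /and3P[_ _ /eqP bE]] := valP b.
rewrite /bip_side; case: pickP => [//|/(_ S)].
by rewrite bE !inE eqxx.
Qed.

Lemma bip_side_AB_CD :
  bip_side AB_CD = [set legA; legB]%SET \/ bip_side AB_CD = [set legC; legD]%SET.
Proof. by have := bip_sideP AB_CD; rewrite !inE => /orP[] /eqP; [left|right]. Qed.

Lemma setC_AB : finset.setC [set legA; legB]%SET = [set legC; legD]%SET.
Proof. by apply/finset.setP => j; rewrite !inE; case: j => [[|[|[|[|]]]] ?]. Qed.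

Lemma card_bip_side_AB_CD :
  #|bip_side AB_CD| = 2%N /\ #|finset.setC (bip_side AB_CD)| = 2%N.
Proof.
by case: bip_side_AB_CD => ->; rewrite -?setC_AB ?finset.setCK setC_AB !cards2.
Qed.

Lemma restr_bits_AB (S : {set 'I_4}) (i i' j j' : 'I_4) : S = [set legA; legB]%SET ->
  restr S (bits_midx i j) = restr S (bits_midx i' j') <-> i = i'.
Proof.
move=> ->; split=> [/ffunP H|->].
  have hA := H (exist _ legA (finset.set21 _ _)).
  have hB := H (exist _ legB (finset.set22 _ _)).
  by rewrite !ffunE /tnth /= in hA hB; apply: bits_inj.
apply/ffunP => -[l lS]; rewrite !ffunE /=.
by move: lS; rewrite !inE => /orP[] /eqP ->.
Qed.

Lemma restr_bits_CD (S : {set 'I_4}) (i i' j j' : 'I_4) : S = [set legC; legD]%SET ->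
  restr S (bits_midx i j) = restr S (bits_midx i' j') <-> j = j'.
Proof.
move=> ->; split=> [/ffunP H|->].
  have hA := H (exist _ legC (finset.set21 _ _)).
  have hB := H (exist _ legD (finset.set22 _ _)).
  by rewrite !ffunE /tnth /= in hA hB; apply: bits_inj.
apply/ffunP => -[l lS]; rewrite !ffunE /=.
by move: lS; rewrite !inE => /orP[] /eqP ->.
Qed.

(** Which of AB and CD is [bip_side AB_CD] depends on an enumeration; the two cases
    are exchanged by transposition. *)
Lemma det_gram_AB_CD (R : realType) (psi : tensor R 4 2) :
  let F := flattening (bip_side AB_CD) psi in
  \det (F *m F^t* ) = `|\det (AB_CD_mx psi)| ^+ 2.
Proof.
have [c1 c2] := card_bip_side_AB_CD.
have m4 : #|{: sub_midx 2 (bip_side AB_CD)}| = 4%N by rewrite card_sub_midx c1.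
have n4 : #|{: sub_midx 2 (finset.setC (bip_side AB_CD))}| = 4%N.
  by rewrite card_sub_midx c2.
pose row_idx (x : midx 4 2) := enum_rank (restr (bip_side AB_CD) x).
pose col_idx (x : midx 4 2) := enum_rank (restr (finset.setC (bip_side AB_CD)) x).
have FE (x : midx 4 2) :
    flattening (bip_side AB_CD) psi (row_idx x) (col_idx x) = psi x.
  exact: flatteningE.
move=> F; case: bip_side_AB_CD => SE.
- have S'E : finset.setC (bip_side AB_CD) = [set legC; legD]%SET.
    by rewrite SE setC_AB.
  apply: (@det_gram_reindex _ 4 _ _ F (AB_CD_mx psi)
    (fun i : 'I_4 => row_idx (bits_midx i 0%N))
    (fun j : 'I_4 => col_idx (bits_midx 0%N j)) m4 n4).
  + by move=> i i' /enum_rank_inj /(restr_bits_AB _ _ (@ord0 3) (@ord0 3) SE).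
  + by move=> i i' /enum_rank_inj /(restr_bits_CD (@ord0 3) (@ord0 3) _ _ S'E).
  + move=> i j; rewrite mxE -FE /F /row_idx /col_idx.
    have -> := (restr_bits_AB i i (@ord0 3) j SE).2 erefl.
    by have -> := (restr_bits_CD (@ord0 3) i j j S'E).2 erefl.
- have S'E : finset.setC (bip_side AB_CD) = [set legA; legB]%SET.
    by rewrite SE -setC_AB finset.setCK.
  rewrite -[in RHS]det_tr; apply: (@det_gram_reindex _ 4 _ _ _ _
    (fun j : 'I_4 => row_idx (bits_midx 0%N j))
    (fun i : 'I_4 => col_idx (bits_midx i 0%N)) m4 n4).
  + by move=> i i' /enum_rank_inj /(restr_bits_CD (@ord0 3) (@ord0 3) _ _ SE).
  + by move=> i i' /enum_rank_inj /(restr_bits_AB _ _ (@ord0 3) (@ord0 3) S'E).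
  + move=> i j; rewrite !mxE -FE /F /row_idx /col_idx.
    have -> := (restr_bits_CD (@ord0 3) j i i SE).2 erefl.
    by have -> := (restr_bits_AB j j (@ord0 3) i S'E).2 erefl.
Qed.

Lemma log2_2 (R : realType) : log2 (2 : R) = 1.
Proof. by rewrite /log2 divff // gt_eqF // ln2_gt0. Qed.

Lemma log2_4 (R : realType) : log2 (4 : R) = 2.
Proof.
have -> : 4 = 2 ^+ 2 :> R by rewrite -natrX.
by rewrite /log2 lnXn // mulrnAl divff ?gt_eqF ?ln2_gt0.
Qed.

Section LowerBound.
Variables (R : realType) (p : R).
Hypothesis p01 : 0 < p < 1.
Variable A : 'I_4 -> 'M[R[i]]_2.
Hypothesis A_unit : forall j, A j \in unitmx.

Let phi := local_act A (S_tensor p).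

Lemma prod_det_neq0 : \prod_l \det (A l) != 0.
Proof. by apply/prodf_neq0 => l _; rewrite -unitfE -unitmxE. Qed.

Lemma prod_det_le : `|\prod_l \det (A l)| <= inner phi phi.
Proof.
have := pairing_le_norm phi.
by rewrite pairing_local_act pairing_S_tensor // mulr1.
Qed.

Lemma local_act_S_gt0 : 0 < inner phi phi.
Proof. by apply: lt_le_trans prod_det_le; rewrite normr_gt0 prod_det_neq0. Qed.

(** The ratio of the two polynomials has degree zero, so it is constant along
    the orbit; at a unit vector the pairing is at most 1. *)
Lemma det_density_le :
  \det (reduced_density (bip_side AB_CD) phi) <= ((p * (1 - p) / 4) ^+ 2)%:C.
Proof.
have N0 := local_act_S_gt0; set N := inner phi phi in N0.
rewrite /reduced_density detZ det_gram_AB_CD card_sub_midx card_bip_side_AB_CD.1.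
rewrite det_AB_CD_local_act det_AB_CD_S_tensor // normrM exprMn normrX.
rewrite -/N exprVn mulrC ler_pdivrMr ?exprn_gt0 // mulrC [leRHS]mulrC.
set c := (p * (1 - p) / 4); have c0 : 0 <= c.
  by have [p0 p1] := andP p01; rewrite /c; have := mulr_gt0 p0 (_ : 0 < 1 - p); lra.
rewrite (ger0_norm (_ : 0 <= c%:C)) ?ler0c // -rmorphXn /= mulrC.
apply: ler_wpM2r; first by rewrite ler0c exprn_ge0.
rewrite -exprM; apply: lerXn2r; rewrite ?nnegrE ?normr_ge0 ?(ltW N0) //.
exact: prod_det_le.
Qed.

End LowerBound.

Lemma entropy_AB_CD_gap (R : realType) (p : R) : 0 < p < 1 -> p != 1 / 2 ->
  exists2 eps : R, 0 < eps & forall A : 'I_4 -> 'M[R[i]]_2,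
    (forall j, A j \in unitmx) ->
    bip_entropy AB_CD (local_act A (S_tensor p)) <= 2 - eps.
Proof.
move=> p01 p12; have [p0 p1] := andP p01.
have q0 : 0 < p * (1 - p) by rewrite mulr_gt0 // subr_gt0.
have q1 : 4 * (p * (1 - p)) < 1.
  have : 0 < (p - 1 / 2) ^+ 2 by rewrite exprn_even_gt0 //= subr_eq0.
  by lra.
(* 4 ^+ 4 times the bound (p (1 - p) / 4) ^+ 2 of det_density_le *)
pose c := (4 * (p * (1 - p))) ^+ 2.
have c01 : 0 <= c < 1.
  by rewrite /c sqr_ge0 expr_lt1 //; lra.
have m4 : #|{: sub_midx 2 (bip_side AB_CD)}| = 4%N.
  by rewrite card_sub_midx card_bip_side_AB_CD.1.
have m0 : (0 < #|{: sub_midx 2 (bip_side AB_CD)}|)%N by rewrite m4.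
have [eps eps0 H] := shannon_gap m0 c01.
exists eps => // A A_unit; set phi := local_act A _.
have N0 : 0 < inner phi phi := local_act_S_gt0 p01 A_unit.
have Ninv : 0 <= (inner phi phi)^-1 by rewrite invr_ge0 ltW.
have tr1 := density_trace (bip_side AB_CD) (lt0r_neq0 N0).
rewrite -log2_4.
have <- : #|{: sub_midx 2 (bip_side AB_CD)}|%:R = 4 :> R by rewrite m4.
apply: H.
- exact: gram_eigenvalue_ge0.
- exact: gram_eigenvalue_sum.
- rewrite big_split /= prodr_const card_ord.
  have := det_density_le p01 A_unit.
  rewrite /reduced_density -gram_eigenvalue_prod // lecR.
  set P := (X in X <= _) => h; rewrite -[X in _ * X <= _]/P m4.
  apply: le_trans (ler_wpM2l _ h) _; first by rewrite exprn_ge0.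
  rewrite /c; lra.
Qed.

(** * Isotypic components *)

Section Isotypic.
Variables (R : realType) (k d n : nat) (S : {set 'I_k}).
Implicit Types (Phi Psi : tpower R k d n) (x : pidx k d n) (s t : 'S_n).

Lemma permute_legsM s t x :
  permute_legs S s (permute_legs S t x) = permute_legs S (s * t)%g x.
Proof.
apply/ffunP => a; apply/ffunP => j; rewrite !ffunE permM.
by case: (j \in S).
Qed.

Lemma leg_actM s t Phi : leg_act S s (leg_act S t Phi) = leg_act S (s * t)%g Phi.
Proof. by apply/ffunP => x; rewrite !ffunE permute_legsM invMg. Qed.

Fact leg_act_linear s : linear (@leg_act R k d n S s).
Proof. by move=> a Phi Psi; apply/ffunP => x; rewrite !ffunE. Qed.

HB.instance Definition _ s := GRing.isLinear.Build (R[i]) _ _ _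
  (@leg_act R k d n S s) (leg_act_linear s).

Lemma isotypic0 lambda : isotypic (R := R) (d := d) (n := n) S lambda 0.
Proof. by exists [::]; split=> //; rewrite mem0v. Qed.

Lemma isotypic_lin lambda (a : R[i]) Phi Psi :
  isotypic S lambda Phi -> isotypic S lambda Psi ->
  isotypic S lambda (a *: Phi + Psi).
Proof.
move=> [fs [fsP Phi_fs]] [gs [gsP Psi_gs]]; exists (fs ++ gs); split.
  by move=> f; rewrite mem_cat => /orP[/fsP|/gsP].
by rewrite big_cat memv_add // memvZ.
Qed.

(** [y |-> y Phi], the module generated by [Phi] as a quotient of the group
    algebra. *)
Definition orbit_map Phi (y : group_alg R n) : tpower R k d n :=
  \sum_g (y g : R[i]) *: leg_act S g Phi.

Fact orbit_map_linear Phi : linear (orbit_map Phi).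
Proof.
move=> a y z; rewrite /orbit_map scaler_sumr -big_split /=.
by apply: eq_bigr => g _; rewrite !ffunE scalerDl scalerA.
Qed.

HB.instance Definition _ Phi := GRing.isLinear.Build (R[i]) _ _ _
  (orbit_map Phi) (orbit_map_linear Phi).

Lemma orbit_map_ga_act Phi s y :
  orbit_map Phi (ga_act s y) = leg_act S s (orbit_map Phi y).
Proof.
rewrite /orbit_map linear_sum (reindex_inj (mulgI s)) /=.
by apply: eq_bigr => g _; rewrite ffunE mulKg linearZ /= leg_actM.
Qed.

(** [leg_act S s] is moved inside, where it permutes the generators of the
    Specht module. *)
Lemma orbit_map_isotypic lambda Phi s :
  isotypic S lambda (leg_act S s (orbit_map Phi (young_sym R n lambda))).
Proof.
exists [:: linfun (orbit_map Phi)]; split.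
  move=> f; rewrite inE => /eqP -> t y _.
  by rewrite !lfunE /= orbit_map_ga_act.
rewrite big_seq1 -orbit_map_ga_act.
set y := young_sym R n lambda.
have -> : orbit_map Phi (ga_act s y) = linfun (orbit_map Phi) (ga_act s y).
  by rewrite lfunE.
apply: memv_img; apply: memv_span; rewrite /=.
by apply: (map_f (fun s => ga_act s y)); rewrite mem_enum.
Qed.

Lemma orbit_map_young lambda Phi :
  orbit_map Phi (young_sym R n lambda) =
  \sum_(r in row_stab n lambda) \sum_(q in col_stab n lambda)
    ((-1) ^+ odd_perm q : R[i]) *: leg_act S (r * q)%g Phi.
Proof.
rewrite /orbit_map.
under eq_bigr => g _ do rewrite ffunE scaler_suml.
rewrite exchange_big /=; apply: eq_bigr => r _.
under eq_bigr => g _ do rewrite scaler_suml big_mkcondr /=.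
rewrite exchange_big /=; apply: eq_bigr => q _.
by rewrite -big_mkcond /= (big_pred1 (r * q)%g) // => g; rewrite eq_sym.
Qed.

End Isotypic.

Section SuppProj.
Variables (R : realType) (k d n : nat) (theta : {ffun bipartition k -> R}).
Variable lambda : bipartition k -> seq nat.

(** The projectors are self-adjoint and each fixes [Om], so in whatever order they
    are composed they preserve the inner product with [Om]. *)
Lemma inner_supp_proj (Phi Om : tpower R k d n) :
  @Defs.symmetric R k d n Om ->
  {in bip_supp theta, forall b, isotypic (bip_side b) (lambda b) Om} ->
  inner (supp_proj theta lambda Phi) Om = inner Phi Om.
Proof.
move=> Om_sym Om_iso; rewrite /supp_proj.
have : {subset enum (bip_supp theta) <= bip_supp theta}.
  by move=> b; rewrite mem_enum.
elim: (enum _) => [//|b s IH] sP /=.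
rewrite /bip_proj /isotypic_proj inner_oproj; first rewrite inner_oproj //.
- by apply: IH => c cs; apply: sP; rewrite inE cs orbT.
- by move=> s'; rewrite linear0.
- by move=> a u v uP vP s'; rewrite linearP /= uP vP.
- exact: isotypic0.
- exact: isotypic_lin.
- by apply: Om_iso; apply: sP; rewrite mem_head.
Qed.

End SuppProj.

(** * Two Young symmetrizers of S_4 *)

(** The four copies, which are also the entries of the tableaux. *)
Definition c0 : 'I_4 := @Ordinal 4 0 isT.
Definition c1 : 'I_4 := @Ordinal 4 1 isT.
Definition c2 : 'I_4 := @Ordinal 4 2 isT.
Definition c3 : 'I_4 := @Ordinal 4 3 isT.

Lemma ord4_case (i : 'I_4) : [\/ i = c0, i = c1, i = c2 | i = c3].
Proof.
case: i => [[|[|[|[|?]]]] ?] //;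
  [constructor 1|constructor 2|constructor 3|constructor 4]; exact: val_inj.
Qed.

Local Notation t01 := (tperm c0 c1).
Local Notation t23 := (tperm c2 c3).
Local Notation t02 := (tperm c0 c2).
Local Notation t13 := (tperm c1 c3).
Local Notation t12 := (tperm c1 c2).

Lemma tperm4E :
  ((t01 c0 = c1) * (t01 c1 = c0) * (t01 c2 = c2) * (t01 c3 = c3) *
   (t23 c0 = c0) * (t23 c1 = c1) * (t23 c2 = c3) * (t23 c3 = c2) *
   (t02 c0 = c2) * (t02 c1 = c1) * (t02 c2 = c0) * (t02 c3 = c3) *
   (t13 c0 = c0) * (t13 c1 = c3) * (t13 c2 = c2) * (t13 c3 = c1) *
   (t12 c0 = c0) * (t12 c1 = c2) * (t12 c2 = c1) * (t12 c3 = c3))%type.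
Proof. by rewrite !permE. Qed.

Lemma pair_perm (r : 'S_4) (a b : 'I_4) : a != b ->
  r a = a \/ r a = b -> r b = a \/ r b = b ->
  (r a = a /\ r b = b) \/ (r a = b /\ r b = a).
Proof.
move=> /eqP ab [ra|ra] [rb|rb]; [|by left|by right|];
  by case: ab; apply: (@perm_inj _ r); rewrite ra rb.
Qed.

Definition klein_set (s t : 'S_4) : {set 'S_4} :=
  (1 |: (s |: (t |: [set s * t])))%g.

(** Two blocks [{a, b}] and [{c, d}]: a permutation preserving both acts on each by
    the identity or by the transposition. *)
Lemma stab_two_blocks (f : 'I_4 -> nat) (a b c d : 'I_4) :
  (forall i, [\/ i = a, i = b, i = c | i = d]) -> a != b -> c != d ->
  f a = f b -> f c = f d -> f a != f c ->
  [set r : 'S_4 | [forall i, f (r i) == f i]]%SET =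
  klein_set (tperm a b) (tperm c d).
Proof.
move=> cover ab cd fab fcd fac.
have ac : c != a by apply: contraNneq fac => ->.
have ad : d != a by apply: contraNneq fac => <-; rewrite fcd.
have bc : c != b by apply: contraNneq fac => ->; rewrite fab.
have bd : d != b by apply: contraNneq fac; rewrite fab fcd => ->.
have [ca da cb db] := And4 ac ad bc bd.
have [ac' ad' bc' bd'] : [/\ a != c, a != d, b != c & b != d].
  by rewrite ![_ == c]eq_sym ![_ == d]eq_sym.
have fca : f c != f a by rewrite eq_sym.
apply/finset.setP => r; rewrite !inE; apply/forallP/idP => [H|].
  have inAB i : f (r i) == f a -> r i = a \/ r i = b.
    have [->|->|->|->] := cover (r i); [by left|by right| |];
      by rewrite -?fcd (negPf fca).
  have inCD i : f (r i) == f c -> r i = c \/ r i = d.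
    have [->|->|->|->] := cover (r i); [| |by left|by right];
      by rewrite -?fab (negPf fac).
  have ra := inAB a (H a); have rc := inCD c (H c).
  have rb : r b = a \/ r b = b by apply: inAB; rewrite fab.
  have rd : r d = c \/ r d = d by apply: inCD; rewrite fcd.
  have eq_r (t : 'S_4) : r a = t a -> r b = t b -> r c = t c -> r d = t d -> r = t.
    by move=> ha hb hc hd; apply/permP => i; have [->|->|->|->] := cover i.
  have [[ha hb]|[ha hb]] := pair_perm ab ra rb;
    have [[hc hd]|[hc hd]] := pair_perm cd rc rd; apply/or4P.
  - by constructor 1; apply/eqP/eq_r; rewrite perm1.
  - by constructor 3; apply/eqP/eq_r; rewrite ?tpermL ?tpermR ?tpermD.
  - by constructor 2; apply/eqP/eq_r; rewrite ?tpermL ?tpermR ?tpermD.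
  - constructor 4; apply/eqP/eq_r; rewrite permM.
    + by rewrite tpermL tpermD.
    + by rewrite tpermR tpermD.
    + by rewrite (@tpermD _ a b c) // tpermL.
    + by rewrite (@tpermD _ a b d) // tpermR.
have f_ab i : f (tperm a b i) = f i by case: tpermP => [->|->|].
have f_cd i : f (tperm c d i) = f i by case: tpermP => [->|->|].
by move=> /or4P[] /eqP -> i; rewrite ?permM ?perm1 ?f_cd ?f_ab.
Qed.

Lemma row_stab22 : row_stab 4 [:: 2; 2] = klein_set t01 t23.
Proof.
apply: (@stab_two_blocks (cell_row [:: 2; 2] : 'I_4 -> nat)) => // i.
exact: ord4_case.
Qed.

Lemma col_stab22 : col_stab 4 [:: 2; 2] = klein_set t02 t13.
Proof.
apply: (@stab_two_blocks (cell_col [:: 2; 2] : 'I_4 -> nat)) => // i.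
by have [] := ord4_case i; [constructor 1|constructor 3|constructor 2|constructor 4].
Qed.

Lemma sum_klein (V : zmodType) (F : 'S_4 -> V) (s t : 'S_4) :
  s != 1%g -> t != 1%g -> s != t -> (s * t)%g != 1%g ->
  \sum_(r in klein_set s t) F r = F 1%g + F s + F t + F (s * t)%g.
Proof.
move=> s1 t1 st st1; rewrite /klein_set !big_setU1 ?big_set1 /= ?addrA //.
- by rewrite inE -{1}(mul1g t) (inj_eq (mulIg t)) eq_sym.
- by rewrite !inE negb_or st -{1}(mulg1 s) (inj_eq (mulgI s)) eq_sym.
- by rewrite !inE !negb_or ![1%g == _]eq_sym s1 t1.
Qed.

Lemma sum_row22 (V : zmodType) (F : 'S_4 -> V) :
  \sum_(r in row_stab 4 [:: 2; 2]) F r =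
  F 1%g + F t01 + F t23 + F (t01 * t23)%g.
Proof.
rewrite row_stab22 sum_klein //; apply/eqP => /permP.
- by move=> /(_ c0); rewrite perm1 tperm4E.
- by move=> /(_ c2); rewrite perm1 tperm4E.
- by move=> /(_ c2); rewrite !tperm4E.
- by move=> /(_ c2); rewrite permM perm1 !tperm4E.
Qed.

Lemma sum_col22 (R : realType) (V : lmodType R[i]) (F : 'S_4 -> V) :
  \sum_(q in col_stab 4 [:: 2; 2]) ((-1) ^+ odd_perm q : R[i]) *: F q =
  F 1%g - F t02 - F t13 + F (t02 * t13)%g.
Proof.
rewrite col_stab22 sum_klein; first 1 last.
- by apply/eqP => /permP/(_ c0); rewrite perm1 tperm4E.
- by apply/eqP => /permP/(_ c1); rewrite perm1 tperm4E.
- by apply/eqP => /permP/(_ c1); rewrite !tperm4E.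
- by apply/eqP => /permP/(_ c1); rewrite permM perm1 !tperm4E.
rewrite !odd_permM odd_perm1 !odd_tperm /= expr0 expr1.
by rewrite !scale1r !scaleN1r.
Qed.

Lemma row_stab1111 : row_stab 4 [:: 1; 1; 1; 1]%N = [set 1%g]%SET.
Proof.
apply/finset.setP => r; rewrite !inE; apply/forallP/eqP => [H|-> i];
  last by rewrite perm1.
by apply/permP => i; rewrite perm1; have := H i;
  have [] := ord4_case (r i) => ->; have [] := ord4_case i => ->.
Qed.

Lemma col_stab1111 : col_stab 4 [:: 1; 1; 1; 1]%N = [set: 'S_4]%SET.
Proof.
apply/finset.setP => r; rewrite !inE; apply/forallP => i.
by have [] := ord4_case (r i) => ->; have [] := ord4_case i => ->.
Qed.

(** Every permutation contributes the same term to the Young symmetrizer. *)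
Lemma isotypic1111 (R : realType) k d (S : {set 'I_k}) (Phi : tpower R k d 4) :
  (forall s, leg_act S s Phi = ((-1) ^+ odd_perm s : R[i]) *: Phi) ->
  isotypic S [:: 1; 1; 1; 1]%N Phi.
Proof.
move=> Phi_sgn; pose Psi := orbit_map S Phi (young_sym R 4 [:: 1; 1; 1; 1]%N).
have PsiE : Psi = (4`!)%:R *: Phi.
  rewrite /Psi orbit_map_young row_stab1111 big_set1 col_stab1111 /=.
  transitivity (\sum_(q in [set: 'S_4]%SET) Phi).
    apply: eq_bigr => q _.
    by rewrite mul1g Phi_sgn scalerA -expr2 sqrr_sign scale1r.
  by rewrite sumr_const cardsT card_Sn scaler_nat.
have -> : Phi = ((4`!)%:R)^-1 *: (leg_act S 1%g Psi) + 0.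
  have nz : (4`!)%:R != 0 :> R[i] by rewrite pnatr_eq0.
  by rewrite addr0 PsiE linearZ /= Phi_sgn odd_perm1 scale1r scalerA mulVf ?scale1r.
by apply: isotypic_lin; [apply: orbit_map_isotypic|apply: isotypic0].
Qed.

(** On the two-dimensional representation of S_4 the Klein four-group acts
    trivially, so the Young symmetrizer acts as [4 (1 + s)(1 - t)] for two
    reflections [s], [t] of the triangle; its sum with its conjugate by the third
    reflection is the scalar 12. *)
Lemma isotypic22 (R : realType) k d (S : {set 'I_k}) (Phi : tpower R k d 4) :
  \sum_(r in row_stab 4 [:: 2; 2]) \sum_(q in col_stab 4 [:: 2; 2])
    ((-1) ^+ odd_perm q : R[i]) *:
      (leg_act S (r * q)%g Phi + leg_act S (t12 * (r * q) * t12)%g Phi)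
    = 12%:R *: Phi ->
  isotypic S [:: 2; 2] Phi.
Proof.
move=> sumE; pose c := young_sym R 4 [:: 2; 2].
pose Psi := leg_act S 1%g (orbit_map S Phi c)
  + leg_act S t12 (orbit_map S (leg_act S t12 Phi) c).
have PsiE : Psi = 12%:R *: Phi.
  rewrite -sumE /Psi /c !orbit_map_young !linear_sum -big_split /=.
  apply: eq_bigr => r _; rewrite !linear_sum -big_split /=.
  apply: eq_bigr => q _; rewrite !linearZ /= -scalerDr.
  by rewrite !leg_actM mul1g !mulgA.
have -> : Phi = 12%:R^-1 *: Psi + 0.
  have nz : 12%:R != 0 :> R[i] by rewrite pnatr_eq0.
  by rewrite addr0 PsiE scalerA mulVf ?scale1r.
apply: isotypic_lin; last exact: isotypic0.
rewrite /Psi -[leg_act S 1%g _]scale1r.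
by apply: isotypic_lin; apply: orbit_map_isotypic.
Qed.

(** * The test vector *)

Section TestVector.
Variable R : realType.
Implicit Types (v w : 'I_4 -> R[i]) (x : pidx 4 2 4).

(** Products of area forms over two pairings of the four copies, the area form of two
    indices 0 or 1 being their difference.  They span the multilinear SL_2-invariants
    of four vectors of the plane, on which S_4 acts by its two-dimensional
    representation. *)
Definition pair01_23 v := (v c1 - v c0) * (v c3 - v c2).
Definition pair02_13 v := (v c2 - v c0) * (v c3 - v c1).

(** Up to sign the determinant of the four vectors [e_(v i) (x) e_(w i)]: in the
    tensor square of the two-dimensional representation this is the only vector, up
    to a scalar, on which S_4 acts by the sign. *)
Definition vol v w := pair02_13 v * pair01_23 w - pair01_23 v * pair02_13 w.

Definition leg_val (j : 'I_4) x : 'I_4 -> R[i] := fun a => (x a j)%:R.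

Definition test_vector : tpower R 4 2 4 :=
  [ffun x => vol (leg_val legA x) (leg_val legB x) *
             vol (leg_val legC x) (leg_val legD x)].

Lemma leg_val_permute S s j x :
  leg_val j (permute_legs S s x) = if j \in S then leg_val j x \o s else leg_val j x.
Proof. by apply/funext => a; rewrite /leg_val !ffunE; case: ifP. Qed.

Lemma vol_tperm v w (i j : 'I_4) : i != j ->
  vol (v \o tperm i j) (w \o tperm i j) = - vol v w.
Proof.
rewrite /vol /pair01_23 /pair02_13 /= !permE /=.
by have [] := ord4_case i => ->; have [] := ord4_case j => -> //= _; ring.
Qed.

Lemma comp_permM v (s t : 'S_4) : v \o (s * t)%g = (v \o t) \o s.
Proof. by apply/funext => a; rewrite /= permM. Qed.

Lemma comp_perm1 v : v \o (1%g : 'S_4) = v.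
Proof. by apply/funext => a; rewrite /= perm1. Qed.

Lemma vol_perm v w (s : 'S_4) :
  vol (v \o s) (w \o s) = (-1) ^+ odd_perm s * vol v w.
Proof.
have [ts -> /=] := prod_tpermP s; elim: ts v w => [|[i j] ts IH] v w /=.
  by rewrite big_nil odd_perm1 mul1r !comp_perm1.
move=> /andP[/= ij /IH {}IH]; rewrite big_cons /=.
by rewrite !comp_permM vol_tperm // IH odd_permM odd_tperm ij /= signrN mulNr.
Qed.

Lemma test_vector_permute_all s x :
  test_vector (permute_legs [set: 'I_4]%SET s x) = test_vector x.
Proof.
rewrite !ffunE !leg_val_permute !inE !vol_perm mulrACA -expr2 sqrr_sign.
by rewrite mul1r.
Qed.

Lemma test_vector_symmetric : @Defs.symmetric R 4 2 4 test_vector.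
Proof. by move=> s; apply/ffunP => x; rewrite ffunE test_vector_permute_all. Qed.

(** A permutation of all legs fixes the test vector, so permuting the complement of
    [S] undoes a permutation of [S].  This makes the choice of side harmless. *)
Lemma test_vector_permute_setC S s x :
  test_vector (permute_legs (finset.setC S) s x) =
  test_vector (permute_legs S s^-1%g x).
Proof.
rewrite -[RHS](test_vector_permute_all s); congr (test_vector _).
apply/ffunP => a; apply/ffunP => j.
by rewrite !ffunE !inE; case: (j \in S) => //=; rewrite permK.
Qed.

Lemma test_vector_isotypic1111 :
  isotypic (bip_side AB_CD) [:: 1; 1; 1; 1]%N test_vector.
Proof.
apply: isotypic1111 => s; apply/ffunP => x; rewrite ffunE [RHS]ffunE.
rewrite -(odd_permV s); case: bip_side_AB_CD => ->.
  by rewrite !ffunE !leg_val_permute !inE /= vol_perm -mulrA.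
by rewrite !ffunE !leg_val_permute !inE /= vol_perm mulrCA.
Qed.

(** As a function of one leg the test vector stays in the two-dimensional space of
    invariants, with coefficients depending on the other three legs. *)
Lemma test_vector_permute_leg j x : exists a b : R[i], forall s : 'S_4,
  test_vector (permute_legs [set j]%SET s x) =
  a * pair01_23 (leg_val j x \o s) + b * pair02_13 (leg_val j x \o s).
Proof.
pose t1 l := pair01_23 (leg_val l x); pose t2 l := pair02_13 (leg_val l x).
pose vAB := vol (leg_val legA x) (leg_val legB x).
pose vCD := vol (leg_val legC x) (leg_val legD x).
have [->|->|->|->] := ord4_case j.
- exists (- t2 legB * vCD), (t1 legB * vCD) => s.
  by rewrite ffunE !leg_val_permute !inE /= -/vCD /vol /t1 /t2; ring.
- exists (t2 legA * vCD), (- t1 legA * vCD) => s.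
  by rewrite ffunE !leg_val_permute !inE /= -/vCD /vol /t1 /t2; ring.
- exists (- t2 legD * vAB), (t1 legD * vAB) => s.
  by rewrite ffunE !leg_val_permute !inE /= -/vAB /vol /t1 /t2; ring.
- exists (t2 legC * vAB), (- t1 legC * vAB) => s.
  by rewrite ffunE !leg_val_permute !inE /= -/vAB /vol /t1 /t2; ring.
Qed.

Lemma pair01_23_tperm v :
  ((pair01_23 (v \o t01) = - pair01_23 v) *
   (pair01_23 (v \o t23) = - pair01_23 v) *
   (pair01_23 (v \o t02) = pair01_23 v - pair02_13 v) *
   (pair01_23 (v \o t13) = pair01_23 v - pair02_13 v) *
   (pair01_23 (v \o t12) = pair02_13 v))%type.
Proof. by rewrite /pair01_23 /pair02_13 /= !tperm4E; do !split; ring. Qed.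

Lemma pair02_13_tperm v :
  ((pair02_13 (v \o t01) = pair02_13 v - pair01_23 v) *
   (pair02_13 (v \o t23) = pair02_13 v - pair01_23 v) *
   (pair02_13 (v \o t02) = - pair02_13 v) *
   (pair02_13 (v \o t13) = - pair02_13 v) *
   (pair02_13 (v \o t12) = pair01_23 v))%type.
Proof. by rewrite /pair01_23 /pair02_13 /= !tperm4E; do !split; ring. Qed.

(** With [h] the inversion this is the left action on polynomials in [v], which
    permutations of one leg induce; with [h] the identity it is the right action,
    which permutations of the complementary legs induce on a symmetric vector. *)
Lemma young22_sum (a b : R[i]) v (h : 'S_4 -> 'S_4) :
  h =1 id \/ h =1 invg ->
  \sum_(r in row_stab 4 [:: 2; 2]) \sum_(q in col_stab 4 [:: 2; 2])
    ((-1) ^+ odd_perm q : R[i]) *: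
      ((a * pair01_23 (v \o h (r * q)%g) + b * pair02_13 (v \o h (r * q)%g)) +
       (a * pair01_23 (v \o h (t12 * (r * q) * t12)%g) +
        b * pair02_13 (v \o h (t12 * (r * q) * t12)%g)) : R[i]^o) =
  12%:R * (a * pair01_23 v + b * pair02_13 v).
Proof.
case=> hE; rewrite sum_row22 !sum_col22 !hE;
  rewrite ?invMg ?tpermV ?invg1 !comp_permM !comp_perm1;
  rewrite !(pair01_23_tperm, pair02_13_tperm); ring.
Qed.

Lemma isotypic22_leg S (j : 'I_4) (h : 'S_4 -> 'S_4) : h =1 id \/ h =1 invg ->
  (forall s x, leg_act S s test_vector x =
               test_vector (permute_legs [set j]%SET (h s) x)) ->
  isotypic S [:: 2; 2] test_vector.
Proof.
move=> hE actE; apply: isotypic22; apply/ffunP => x.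
have [a [b E]] := test_vector_permute_leg j x.
have E1 : test_vector x =
    a * pair01_23 (leg_val j x) + b * pair02_13 (leg_val j x).
  rewrite -[leg_val j x]comp_perm1 -E; congr (test_vector _).
  by apply/ffunP => i; apply/ffunP => l; rewrite !ffunE perm1 if_same.
rewrite [RHS]ffunE [in RHS]E1 -[RHS](young22_sum _ _ _ hE) sum_ffunE.
apply: eq_bigr => r _; rewrite sum_ffunE; apply: eq_bigr => q _.
by rewrite ffunE [in LHS]ffunE !actE !E.
Qed.

Lemma test_vector_isotypic22 S j : S = [set j]%SET \/ S = finset.setC [set j]%SET ->
  isotypic S [:: 2; 2] test_vector.
Proof.
case=> ->.
  apply: (@isotypic22_leg _ j invg); first by right.
  by move=> s x; rewrite ffunE.
apply: (@isotypic22_leg _ j id); first by left.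
by move=> s x; rewrite ffunE test_vector_permute_setC invgK.
Qed.

Lemma vol_real v w : (forall a, v a \is Num.real) -> (forall a, w a \is Num.real) ->
  vol v w \is Num.real.
Proof. by move=> vR wR; rewrite /vol /pair01_23 /pair02_13 !(rpredB, rpredM). Qed.

(** Where the power of [S_p] does not vanish the two factors of [test_vector] agree. *)
Lemma inner_S_tensor_test_vector p : 0 < p < 1 ->
  0 < inner (tens_pow 4 (S_tensor p)) test_vector.
Proof.
move=> p01.
have term_ge0 x :
    0 <= (tens_pow 4 (S_tensor p) x : R[i]) * Num.conj (test_vector x : R[i]).
  case: (boolP [exists a, S_tensor p (x a) == 0]) => [/existsP[a /eqP xa]|].
    by rewrite ffunE (bigD1 a) //= xa !mul0r.
  rewrite negb_exists => /forallP xS; rewrite mulr_ge0 //.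
    by rewrite ffunE prodr_ge0 // => a _; apply: S_tensor_ge0.
  have same a : x a legC = x a legA /\ x a legD = x a legB.
    have := xS a; rewrite S_tensorE; case: ifP => [/andP[/eqP -> /eqP ->]//|_].
    by rewrite eqxx.
  rewrite conjC_ge0 ffunE.
  have -> : leg_val legC x = leg_val legA x.
    by apply/funext => a; rewrite /leg_val (same a).1.
  have -> : leg_val legD x = leg_val legB x.
    by apply/funext => a; rewrite /leg_val (same a).2.
  by rewrite -expr2 real_exprn_even_ge0 // vol_real // => a; apply: realn.
pose x0 : pidx 4 2 4 := [ffun a : 'I_4 => bits_midx a a].
rewrite /inner (bigD1 x0) //= ltr_wpDr ?sumr_ge0 //.
rewrite mulr_gt0 //.
  rewrite ffunE prodr_gt0 // => a _.
  by rewrite [x0 a]ffunE S_tensor_bits !eqxx /= ltcR amplitude_gt0.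
have -> : test_vector x0 = 1 :> R[i].
  by rewrite ffunE /vol /pair01_23 /pair02_13 /leg_val !ffunE /tnth /=; ring.
by rewrite rmorph1.
Qed.

End TestVector.

(** * The gap *)

(** A side of [b] contained in AB or CD is that side itself or a single leg. *)
Lemma laminar_AB_CD (b : bipartition 4) : mutually_laminar b AB_CD -> b != AB_CD ->
  exists j, bip_side b = [set j]%SET \/ bip_side b = finset.setC [set j]%SET.
Proof.
have sideP := bip_sideP b.
have /existsP[S /and3P[S0 ST /eqP bE]] := valP b.
have bipE T : T \in val b -> val b = [set T; finset.setC T]%SET.
  rewrite bE !inE => /orP[] /eqP -> //.
  by rewrite finset.setCK finset.setUC.
move=> /existsP[X /andP[Xb /existsP[Y /andP[YAB XY]]]] bAB.
have X0 : X != finset.set0.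
  move: Xb; rewrite bE !inE => /orP[] /eqP -> //.
  apply: contra ST => /eqP/(congr1 (@finset.setC _)).
  by rewrite finset.setCK finset.setC0 => ->.
have cardY : #|Y| = 2%N.
  by move: YAB; rewrite !inE => /orP[] /eqP ->; rewrite cards2.
have : X != Y.
  apply: contra bAB => /eqP XYE; apply/eqP/val_inj.
  rewrite (bipE X Xb) XYE /=; move: YAB; rewrite !inE => /orP[] /eqP ->.
    by rewrite setC_AB.
  by rewrite -setC_AB finset.setCK finset.setUC.
rewrite eqEcard XY cardY /= -ltnNge ltnS => X1.
have /cards1P[j XE] : #|X| == 1%N by rewrite eqn_leq X1 card_gt0.
exists j; move: Xb; rewrite -XE (bipE _ sideP) !inE => /orP[] /eqP ->; first by left.
by right; rewrite finset.setCK.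
Qed.

Section Gap.
Variables (R : realType) (theta : {ffun bipartition 4 -> R}).
Hypotheses (theta_lam : laminar_distr theta) (theta_AB_CD : 0 < theta AB_CD).
Variable p : R.
Hypothesis p01 : 0 < p < 1.

Lemma supp_AB_CD : AB_CD \in bip_supp theta.
Proof. by rewrite inE gt_eqF. Qed.

Lemma supp_leg b : b \in bip_supp theta -> b != AB_CD ->
  exists j, bip_side b = [set j]%SET \/ bip_side b = finset.setC [set j]%SET.
Proof.
by case: theta_lam => _ _ lam bs; apply: laminar_AB_CD; apply: lam; rewrite ?supp_AB_CD.
Qed.

Lemma lower_functional_le (eps : R) :
  (forall A : 'I_4 -> 'M[R[i]]_2, (forall j, A j \in unitmx) ->
    bip_entropy AB_CD (local_act A (S_tensor p)) <= 2 - eps) ->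
  (lower_functional theta (S_tensor p) <= (1 + theta AB_CD * (1 - eps))%:E)%E.
Proof.
move=> gap; case: (theta_lam) => theta0 theta1 _.
apply: ge_ereal_sup => _ [A [A_unit ->]]; rewrite lee_fin.
have -> : 1 + theta AB_CD * (1 - eps) =
    \sum_b theta b * (1 + (b == AB_CD)%:R * (1 - eps)).
  under [RHS]eq_bigr => b _ do rewrite mulrDr mulr1.
  rewrite big_split /= theta1; congr (1 + _).
  rewrite (bigD1 AB_CD) //= eqxx mul1r big1 ?addr0 // => b /negPf ->.
  by rewrite mul0r mulr0.
apply: ler_sum => b _; case: (eqVneq (theta b) 0) => [->|tb]; first by rewrite !mul0r.
apply: ler_wpM2l => //; case: eqVneq => [->|bAB].
  by apply: le_trans (gap A A_unit) _; rewrite mul1r; lra.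
have bs : b \in bip_supp theta by rewrite inE.
rewrite mul0r addr0 -(@log2_2 R); apply: bip_entropy_le => //.
  exact: lt0r_neq0 (local_act_S_gt0 p01 A_unit).
by have [j [->|->]] := supp_leg bs bAB; rewrite ?finset.setCK cards1 expn1;
  [apply: geq_minl|apply: geq_minr].
Qed.

Lemma shannon_uniform (m : nat) : (0 < m)%N ->
  shannon (nseq m (m%:R^-1 : R)) = log2 m%:R.
Proof.
move=> m0; have mR : m%:R != 0 :> R by rewrite pnatr_eq0 -lt0n.
rewrite /shannon big_nseq iter_addr_0 /log2 lnV ?posrE ?ltr0n //.
have mulrE (y : R) : y *- m = - (m%:R * y) by rewrite mulr_natl.
by rewrite mulrE mulrA mulfV // mul1r mulNr opprK.
Qed.

Definition shape b : seq nat :=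
  if b == AB_CD then [:: 1; 1; 1; 1]%N else [:: 2; 2].

(** The composite of the projections is paired with the test vector, which every one
    of them fixes. *)
Lemma upper_functional_ge :
  ((1 + theta AB_CD)%:E <= upper_functional theta (S_tensor p))%E.
Proof.
apply: ereal_sup_ubound; exists 4%N, shape; split=> //.
- by move=> b _; rewrite /shape; case: ifP.
- apply: contraTneq (inner_S_tensor_test_vector p01) => supp0.
  rewrite -(@inner_supp_proj _ _ _ _ theta shape).
  + by rewrite supp0 linear0l ltxx.
  + exact: test_vector_symmetric.
  + move=> b bs; rewrite /shape; case: eqVneq => [->|bAB].
      exact: test_vector_isotypic1111.
    by have [j bj] := supp_leg bs bAB; apply: test_vector_isotypic22 bj.
- congr EFin; case: theta_lam => theta0 theta1 _.
  rewrite (bigD1 AB_CD) ?supp_AB_CD //= /shape eqxx /=.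
  have u4 : shannon [:: 1 / 4; 1 / 4; 1 / 4; 1 / 4] = 2 :> R.
    by rewrite -[RHS]log2_4 -(shannon_uniform (isT : (0 < 4)%N)) /= !div1r.
  have u2 : shannon [:: 2 / 4; 2 / 4] = 1 :> R.
    rewrite -[RHS]log2_2 -(shannon_uniform (isT : (0 < 2)%N)) /=.
    by have -> : 2 / 4 = 2^-1 :> R by lra.
  rewrite u4 (eq_bigr theta) => [|b /andP[_ /negPf ->]]; last by rewrite u2 mulr1.
  have : \sum_(b in bip_supp theta) theta b = 1.
    rewrite -theta1 [RHS](bigID (mem (bip_supp theta))) /=.
    rewrite [X in _ = _ + X]big1 ?addr0 //.
    by move=> b; rewrite inE negbK => /eqP.
  rewrite (bigD1 AB_CD) ?supp_AB_CD //= => h.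
  by rewrite mulr_natr mulr2n -addrA -h; lra.
Qed.

End Gap.

Theorem proposition3p8 (R : realType) (theta : {ffun bipartition 4 -> R})
    (theta_lam : laminar_distr theta) (theta_AB_CD : 0 < theta AB_CD)
    (p : R) (p_range : (0 < p < 1 / 2) \/ (1 / 2 < p < 1)) :
  (lower_functional theta (S_tensor p) < upper_functional theta (S_tensor p))%E.
Proof.
have p01 : 0 < p < 1 by case: p_range => /andP[h1 h2]; apply/andP; split; lra.
have p12 : p != 1 / 2.
  by case: p_range => /andP[h1 h2]; [rewrite lt_eqF|rewrite gt_eqF].
have [eps eps0 gap] := entropy_AB_CD_gap p01 p12.
apply: le_lt_trans (lower_functional_le theta_lam theta_AB_CD p01 gap) _.
apply: lt_le_trans (upper_functional_ge theta_lam theta_AB_CD p01).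
by rewrite lte_fin; have := mulr_gt0 theta_AB_CD eps0; lra.
Qed.
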